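(* Let $S_i$ be the simple module at a vertex $i$ of $Q$, assumed exceptional. Let $F=\tau^{-1}S_i$ if $S_i$ is not injective, and otherwise let $F=P_i$. Then the composite $\sigma=\tilde{\pi}_i\iota_F:F^\perp\to S_i^\perp$ is an equivalence of categories.
   Context: $k$ is a field and $Q$ is a finite quiver, possibly with oriented cycles. $\mathrm{Mod}(Q)$ is the category of finitely generated left $kQ$-modules and $\mathrm{Ext}_Q=\mathrm{Ext}^1_{kQ}$. $S_i$ and $P_i$ are the simple and the indecomposable projective module at $i$, and $\tau$ is the Auslander–Reiten translation. A module $E$ is exceptional if $\mathrm{Hom}_Q(E,E)\oplus\mathrm{Ext}_Q(E,E)$ is $1$-dimensional, generated by the identity. Exceptional modules are assumed right and left Hom-finite: $\mathrm{Hom}_Q$ and $\mathrm{Ext}_Q$ from and to any module in $\mathrm{Mod}(Q)$ are finite-dimensional. $E^\perp$ is the full subcategory of modules $N$ with $\mathrm{Hom}_Q(E,N)=\mathrm{Ext}_Q(E,N)=0$, $\iota_E:E^\perp\to\mathrm{Mod}(Q)$ is the inclusion, and $\tilde\pi_E:\mathrm{Mod}(Q)\to E^\perp$ is its left adjoint. $\tilde\pi_i$ means $\tilde\pi_{S_i}$. *)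

(* Defs.v *)
From HB Require Import structures.
From mathcomp Require Import all_boot all_algebra.
From mathcomp Require Import generic_quotient ring_quotient.
From mathcomp Require Import finmap monalg boolp.

Set Implicit Arguments.
Unset Strict Implicit.
Unset Printing Implicit Defensive.

Import GRing.Theory.
Local Open Scope ring_scope.
Local Open Scope quotient_scope.

Reserved Notation "G \oF F" (at level 50, left associativity).

(* [monalg] only makes [{malg R[K]}] a module when [1 != 0] in [R]; the path
   algebra of a quiver is an arbitrary [pzRingType] here. *)
Definition freemod (R : pzRingType) (K : choiceType) : Type := {malg R[K]}.
HB.instance Definition _ (R : pzRingType) (K : choiceType) :=
  GRing.Zmodule.on (freemod R K).

Section FreeModule.
Variables (R : pzRingType) (K : choiceType).
Implicit Types (g : freemod R K) (x : K).

Definition freemod_scale (c : R) g : freemod R K :=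
  [malg x in msupp g => c * g@_x].

Lemma freemod_scaleE c g x : (freemod_scale c g)@_x = c * g@_x.
Proof. by rewrite mcoeffE; case: msuppP; rewrite ?mulr0. Qed.

Fact freemod_scaleA a b g :
  freemod_scale a (freemod_scale b g) = freemod_scale (a * b) g.
Proof. by apply/malgP => x; rewrite !freemod_scaleE mulrA. Qed.
Fact freemod_scale1 : left_id 1 freemod_scale.
Proof. by move=> g; apply/malgP => x; rewrite freemod_scaleE mul1r. Qed.
Fact freemod_scaleDr : right_distributive freemod_scale +%R.
Proof.
by move=> a g h; apply/malgP => x; rewrite !(freemod_scaleE, mcoeffD) mulrDr.
Qed.
Fact freemod_scaleDl g : {morph freemod_scale^~ g : a b / a + b}.
Proof.
by move=> a b; apply/malgP => x; rewrite !(freemod_scaleE, mcoeffD) mulrDl.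
Qed.
HB.instance Definition _ := GRing.Zmodule_isLmodule.Build R (freemod R K)
  freemod_scaleA freemod_scale1 freemod_scaleDr freemod_scaleDl.

Definition fbasis x : freemod R K := << 1 *g x >>.

Definition fcoef x (g : freemod R K) : R^o := g@_x.
Fact fcoef_linear x : linear (fcoef x).
Proof.
by move=> a g h; rewrite /fcoef mcoeffD; congr (_ + _); apply: freemod_scaleE.
Qed.
HB.instance Definition _ x := GRing.isLinear.Build R (freemod R K) R^o *:%R
  (fcoef x) (fcoef_linear x).

Lemma fcoef_basis x y : fcoef y (fbasis x) = (x == y)%:R.
Proof. exact: mcoeffU. Qed.

Section LinExt.
Variables (W : lmodType R) (F : K -> W).

Definition lin_ext (g : freemod R K) : W := \sum_(x <- msupp g) g@_x *: F x.

Lemma lin_extEw (d : {fset K}) g : fsubset (msupp g) d ->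
  lin_ext g = \sum_(x <- d) g@_x *: F x.
Proof.
move=> le_gd; apply: big_fset_incl => // x _ /mcoeff_outdom ->.
by rewrite scale0r.
Qed.

Fact lin_ext_linear : linear lin_ext.
Proof.
move=> a g h; pose d := fsetU (msupp (a *: g + h)) (fsetU (msupp g) (msupp h)).
rewrite (@lin_extEw d) ?fsubsetUl // (@lin_extEw d g); last first.
  by rewrite /d fsetUCA fsubsetUl.
rewrite (@lin_extEw d h); last by rewrite /d fsetUA fsubsetUr.
rewrite scaler_sumr -big_split /=; apply: eq_bigr => x _.
by rewrite scalerA -scalerDl -[_@__]/(fcoef x _) linearP.
Qed.
HB.instance Definition _ := GRing.isLinear.Build R (freemod R K) W *:%R
  lin_ext lin_ext_linear.

Lemma lin_ext_basis x : lin_ext (fbasis x) = F x.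
Proof.
rewrite (lin_extEw msuppU_le) big_seq_fset1.
by rewrite -[_@__]/(fcoef x _) fcoef_basis eqxx scale1r.
Qed.
End LinExt.

Lemma freemod_sum g : g = lin_ext fbasis g.
Proof.
apply/malgP => x; rewrite -[in RHS]/(fcoef x _) linear_sum /= {1}[g]monalgE.
rewrite -[LHS]/(mcoeff x _) raddf_sum /=; apply: eq_bigr => y _.
rewrite mcoeffU linearZ /= fcoef_basis.
by rewrite -[RHS]/(_ * _) mulr_natr.
Qed.

Lemma freemod_ext (W : lmodType R) (f h : {linear freemod R K -> W}) :
  (forall x, f (fbasis x) = h (fbasis x)) -> f =1 h.
Proof.
move=> fh g; rewrite [g]freemod_sum !linear_sum; apply: eq_bigr => x _.
by rewrite !linearZ /= fh.
Qed.

Lemma freemod_extP (W : lmodType R) (f h : freemod R K -> W) :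
  linear f -> linear h -> (forall x, f (fbasis x) = h (fbasis x)) -> f =1 h.
Proof.
move=> lf lh; pose mf := GRing.isLinear.Build R (freemod R K) W *:%R f lf.
pose mh := GRing.isLinear.Build R (freemod R K) W *:%R h lh.
pose F : {linear freemod R K -> W} := HB.pack f mf.
pose H : {linear freemod R K -> W} := HB.pack h mh.
exact: (@freemod_ext W F H).
Qed.
End FreeModule.

Lemma linear_eq (R : pzRingType) (M N : lmodType R) (f g : {linear M -> N}) :
  f =1 g -> f = g.
Proof.
case: f g => [f cf] [g cg] /= /funext fg; move: cf cg; rewrite fg => cf cg.
congr GRing.Linear.Pack; move: cf cg => [[p] [q]] [[p'] [q']].
by rewrite (Prop_irrelevance p p') (Prop_irrelevance q q').
Qed.

Section KerCoker.
Variables (R : pzRingType) (M N : lmodType R) (f : {linear M -> N}).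

Definition ker_pred : pred M := fun x => f x == 0.
Fact ker_pred_closed : subsemimod_closed ker_pred.
Proof.
split; first split.
- by rewrite unfold_in /ker_pred linear0.
- by move=> x y; rewrite !unfold_in /ker_pred linearD => /eqP-> /eqP->;
    rewrite addr0.
by move=> a x; rewrite !unfold_in /ker_pred linearZ /= => /eqP->;
  rewrite scaler0.
Qed.
Definition ker : Type := {x | ker_pred x}.
HB.instance Definition _ := SubChoice.on ker.
HB.instance Definition _ := GRing.SubChoice_isSubLmodule.Build R M ker_pred ker
  ker_pred_closed.

Definition im_pred : pred N := fun y => `[< exists x, f x = y >].
Fact im_pred_closed : subsemimod_closed im_pred.
Proof.
split; first split.
- by apply/asboolP; exists 0; rewrite linear0.
- move=> _ _ /asboolP[x <-] /asboolP[y <-].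
  by apply/asboolP; exists (x + y); rewrite linearD.
by move=> a _ /asboolP[x <-]; apply/asboolP; exists (a *: x); rewrite linearZ.
Qed.
HB.instance Definition _ := GRing.isSubmodClosed.Build R N im_pred
  im_pred_closed.

Local Notation quot_im := (Quotient.quot (GRing.ZmodClosed.clone N im_pred _)).
Definition coker : Type := quot_im.
HB.instance Definition _ := GRing.Zmodule.on coker.

Definition coker_pi (y : N) : coker := \pi_quot_im y.
Definition coker_scale (a : R) (u : coker) : coker :=
  coker_pi (a *: repr (u : quot_im)).

Lemma coker_piP (y z : N) : coker_pi y = coker_pi z <-> exists x, f x = y - z.
Proof.
split=> [/eqP|[x fx]]; first by rewrite -Quotient.idealrBE => /asboolP.
by apply/eqP; rewrite -Quotient.idealrBE; apply/asboolP; exists x.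
Qed.

Lemma coker_piD : {morph coker_pi : y z / y + z}.
Proof. by move=> y z; rewrite /coker_pi raddfD. Qed.

Lemma coker_pi_repr (u : coker) : coker_pi (repr (u : quot_im)) = u.
Proof. exact: reprK. Qed.

Lemma coker_scaleE a y : coker_scale a (coker_pi y) = coker_pi (a *: y).
Proof.
have /coker_piP[x fx] := coker_pi_repr (coker_pi y).
by apply/coker_piP; exists (a *: x); rewrite linearZ /= fx scalerBr.
Qed.

Fact coker_scaleA a b u :
  coker_scale a (coker_scale b u) = coker_scale (a * b) u.
Proof. by rewrite -[u]coker_pi_repr !coker_scaleE scalerA. Qed.
Fact coker_scale1 : left_id 1 coker_scale.
Proof. by move=> u; rewrite -[u]coker_pi_repr coker_scaleE scale1r. Qed.
Fact coker_scaleDr : right_distributive coker_scale +%R.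
Proof.
move=> a u v; rewrite -[u]coker_pi_repr -[v]coker_pi_repr -coker_piD.
by rewrite !coker_scaleE scalerDr coker_piD.
Qed.
Fact coker_scaleDl u : {morph coker_scale^~ u : a b / a + b}.
Proof.
by move=> a b; rewrite -[u]coker_pi_repr !coker_scaleE scalerDl coker_piD.
Qed.
HB.instance Definition _ := GRing.Zmodule_isLmodule.Build R coker
  coker_scaleA coker_scale1 coker_scaleDr coker_scaleDl.
End KerCoker.

(* A left [R]-module together with a commuting left action of [B]. *)
Record bimod (R B : pzRingType) := Bimod {
  bimod_sort :> lmodType R;
  bact : B -> {linear bimod_sort -> bimod_sort};
  bactA : forall a b x, bact a (bact b x) = bact (a * b) x;
  bact1 : forall x, bact 1 x = x;
  bactDl : forall a b x, bact (a + b) x = bact a x + bact b x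
}.

Definition homs (R B : pzRingType) (M : lmodType R) (N : bimod R B) : Type :=
  {linear M -> N}.

Section Homs.
Variables (R B : pzRingType) (M : lmodType R) (N : bimod R B).
Implicit Types f g h : homs M N.

HB.instance Definition _ := gen_eqMixin (homs M N).
HB.instance Definition _ := gen_choiceMixin (homs M N).

Definition homs_add f g : homs M N :=
  (f : {linear M -> N}) \+ (g : {linear M -> N}).
Definition homs_opp f : homs M N := \- (f : {linear M -> N}).
Definition homs_zero : homs M N := (\0 : M -> N).
Fact homs_addA : associative homs_add.
Proof. by move=> f g h; apply: linear_eq => x /=; rewrite addrA. Qed.
Fact homs_addC : commutative homs_add.
Proof. by move=> f g; apply: linear_eq => x /=; rewrite addrC. Qed.
Fact homs_add0 : left_id homs_zero homs_add.
Proof. by move=> f; apply: linear_eq => x /=; rewrite add0r. Qed.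
Fact homs_addN : left_inverse homs_zero homs_opp homs_add.
Proof. by move=> f; apply: linear_eq => x /=; rewrite addNr. Qed.
HB.instance Definition _ := GRing.isZmodule.Build (homs M N)
  homs_addA homs_addC homs_add0 homs_addN.

Definition homs_scale (b : B) f : homs M N := bact N b \o (f : {linear M -> N}).
Fact homs_scaleA a b f : homs_scale a (homs_scale b f) = homs_scale (a * b) f.
Proof. by apply: linear_eq => x /=; rewrite bactA. Qed.
Fact homs_scale1 : left_id 1 homs_scale.
Proof. by move=> f; apply: linear_eq => x /=; rewrite bact1. Qed.
Fact homs_scaleDr : right_distributive homs_scale +%R.
Proof. by move=> a f g; apply: linear_eq => x /=; rewrite linearD. Qed.
Fact homs_scaleDl f : {morph homs_scale^~ f : a b / a + b}.
Proof. by move=> a b; apply: linear_eq => x /=; rewrite bactDl. Qed.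
HB.instance Definition _ := GRing.Zmodule_isLmodule.Build B (homs M N)
  homs_scaleA homs_scale1 homs_scaleDr homs_scaleDl.
End Homs.

Section Ext.
Variables (R B : pzRingType).

Definition homs_pre (M M' : lmodType R) (N : bimod R B) (u : {linear M' -> M})
  (f : homs M N) : homs M' N := (f : {linear M -> N}) \o u.
Fact homs_pre_linear M M' N u : linear (@homs_pre M M' N u).
Proof. by move=> a f g; apply: linear_eq. Qed.
HB.instance Definition _ M M' N u := GRing.isLinear.Build B (homs M N)
  (homs M' N) *:%R (@homs_pre M M' N u) (@homs_pre_linear M M' N u).

(* The canonical free presentation [0 -> syz M -> free_cover M -> M -> 0], with
   [free_cover M] free on the set [M]; [Ext^1_R(M, N)] is the cokernel of
   [Hom_R(free_cover M, N) -> Hom_R(syz M, N)], a left [B]-module. *)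
Definition free_cover (M : lmodType R) : lmodType R := freemod R M.
Definition cover_map (M : lmodType R) : {linear free_cover M -> M} :=
  lin_ext (id : M -> M).
Definition syz (M : lmodType R) : lmodType R := ker (cover_map M).
Definition syz_incl (M : lmodType R) : {linear syz M -> free_cover M} :=
  (val : ker (cover_map M) -> free_cover M).

Definition ext (M : lmodType R) (N : bimod R B) : lmodType B :=
  coker (homs_pre (N := N) (syz_incl M)).
End Ext.

Record quiver := Quiver {
  vert :> finType;
  arr : finType;
  src : arr -> vert;
  tgt : arr -> vert
}.

Section Paths.
Variable Q : quiver.

Fixpoint walk (x : Q) (s : seq (arr Q)) : bool :=
  if s is a :: s' then (src a == x) && walk (tgt a) s' else true.

Definition walk_end (x : Q) (s : seq (arr Q)) : Q := last x (map (@tgt Q) s).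

Lemma walk_cat x s t : walk x (s ++ t) = walk x s && walk (walk_end x s) t.
Proof. by elim: s x => //= a s IH x; rewrite IH andbA. Qed.

Lemma walk_end_cat x s t : walk_end x (s ++ t) = walk_end (walk_end x s) t.
Proof. by rewrite /walk_end map_cat last_cat. Qed.

(* Paths with different sources are distinct, so there is one trivial path per
   vertex: a path is its source with the list of its arrows, in the order in
   which they are traversed. *)
Record qpath : predArgType := QPath {
  qpath_val :> Q * seq (arr Q);
  _ : walk qpath_val.1 qpath_val.2
}.
HB.instance Definition _ := [isSub for qpath_val].
HB.instance Definition _ := [Choice of qpath by <:].

Definition psrc (p : qpath) : Q := p.1.
Definition ptgt (p : qpath) : Q := walk_end p.1 p.2.

Definition ptriv (x : Q) : qpath := @QPath (x, [::]) isT.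

(* [p] after [q], so that left [kQ]-modules are representations of [Q]; only
   meaningful if [psrc p = ptgt q]. *)
Definition qcomp (p q : qpath) : qpath := insubd q (q.1, q.2 ++ p.2).

Lemma qcomp_val p q : psrc p = ptgt q -> val (qcomp p q) = (q.1, q.2 ++ p.2).
Proof.
move=> pq; rewrite insubdK // unfold_in /= walk_cat (valP q) /=.
by rewrite -[walk_end _ _]/(ptgt q) -pq; apply: (valP p).
Qed.

Lemma psrc_comp p q : psrc p = ptgt q -> psrc (qcomp p q) = psrc q.
Proof. by rewrite /psrc => /qcomp_val ->. Qed.

Lemma ptgt_comp p q : psrc p = ptgt q -> ptgt (qcomp p q) = ptgt p.
Proof.
move=> pq; rewrite /ptgt qcomp_val //= walk_end_cat.
by rewrite -[walk_end q.1 q.2]/(ptgt q) -pq.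
Qed.

Lemma qcomp_triv p q i : psrc p = ptgt q ->
  (qcomp p q == ptriv i) = (p == ptriv i) && (q == ptriv i).
Proof.
move=> pq; apply/eqP/andP => [e|[/eqP-> /eqP->]]; last first.
  by apply: val_inj; rewrite qcomp_val.
have := congr1 val e; rewrite qcomp_val //= => -[e1 e2].
have q0 : q = ptriv i.
  case: q e1 e2 {pq e} => -[x [|? ?]] /= w e1 // _.
  by apply: val_inj; rewrite /= e1.
have p0 : p = ptriv i.
  move: pq e2; rewrite q0 {e}; case: p => -[x s] /= w xi s0.
  by apply: val_inj; rewrite /= s0; congr (_, _); apply: xi.
by rewrite p0 q0 !eqxx.
Qed.
End Paths.

Definition path_alg (k : fieldType) (Q : quiver) : Type := freemod k (qpath Q).
HB.instance Definition _ (k : fieldType) (Q : quiver) :=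
  GRing.Lmodule.on (path_alg k Q).

Section PathAlgebra.
Variables (k : fieldType) (Q : quiver).
Local Notation A := (path_alg k Q).
Implicit Types (p q r : qpath Q) (a b c : A).

Definition pvec p : A := fbasis k p.
Definition pvec_mul p q : A := if psrc p == ptgt q then pvec (qcomp p q) else 0.
Definition pa_mul a b : A := lin_ext (fun p => lin_ext (pvec_mul p) b) a.
Definition pa_one : A := \sum_(x : Q) pvec (ptriv x).

Definition pa_rmul b a : A := pa_mul a b.

Lemma pa_rmul_linear b : linear (pa_rmul b).
Proof. by move=> x u v; rewrite /pa_rmul /pa_mul linearP. Qed.
Lemma pa_mul_linear a : linear (pa_mul a).
Proof.
move=> x u v; rewrite /pa_mul /lin_ext scaler_sumr -big_split /=.
apply: eq_bigr => p _; rewrite -!/(lin_ext _ _) linearP scalerDr !scalerA.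
by rewrite mulrC.
Qed.
HB.instance Definition _ b := GRing.isLinear.Build k (freemod k (qpath Q))
  (freemod k (qpath Q)) *:%R (pa_rmul b) (pa_rmul_linear b).
HB.instance Definition _ a := GRing.isLinear.Build k (freemod k (qpath Q))
  (freemod k (qpath Q)) *:%R (pa_mul a) (pa_mul_linear a).

Lemma pa_mul_pvec p q : pa_mul (pvec p) (pvec q) = pvec_mul p q.
Proof. by rewrite /pa_mul !lin_ext_basis. Qed.

Lemma pvec_mulA p q r :
  pa_mul (pvec p) (pvec_mul q r) = pa_mul (pvec_mul p q) (pvec r).
Proof.
have mul0 x : pa_mul 0 x = 0 by exact: (linear0 (pa_rmul x)).
have mulx0 x : pa_mul x 0 = 0 by exact: (linear0 (pa_mul x)).
rewrite /pvec_mul; have [qr|nqr] := eqVneq (psrc q) (ptgt r); last first.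
  rewrite mulx0; case: eqP => [pq|_]; last by rewrite mul0.
  by rewrite pa_mul_pvec /pvec_mul psrc_comp // (negPf nqr).
rewrite pa_mul_pvec /pvec_mul ptgt_comp //.
case: eqP => [pq|_]; last by rewrite mul0.
rewrite pa_mul_pvec /pvec_mul psrc_comp // qr eqxx.
congr pvec; apply: val_inj; rewrite !qcomp_val ?psrc_comp ?ptgt_comp //=.
by rewrite catA.
Qed.

Fact pa_mulA : associative pa_mul.
Proof.
move=> a b c.
apply: (freemod_ext (f := pa_rmul (pa_mul b c))
  (h := (pa_rmul c) \o (pa_rmul b))) => p /=.
apply: (freemod_ext (f := pa_mul (pvec p) \o (pa_rmul c))
  (h := (pa_rmul c) \o pa_mul (pvec p))) => q /=.
apply: (freemod_ext (f := pa_mul (pvec p) \o pa_mul (pvec q))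
  (h := pa_mul (pa_mul (pvec p) (pvec q)))) => r /=.
by rewrite -!/(pvec _) !pa_mul_pvec pvec_mulA.
Qed.

Fact pa_mul1 : left_id pa_one pa_mul.
Proof.
apply: (freemod_ext (f := pa_mul pa_one) (h := idfun)) => p /=.
rewrite -/(pvec p) /pa_one -[LHS]/(pa_rmul (pvec p) _) linear_sum /=
  /pa_rmul.
rewrite (bigD1 (ptgt p)) //= big1 ?addr0 => [|x /negPf xp].
  rewrite pa_mul_pvec /pvec_mul eqxx; congr pvec.
  by apply: val_inj; rewrite qcomp_val //= cats0 -surjective_pairing.
by rewrite pa_mul_pvec /pvec_mul xp.
Qed.

Fact pa_mulr1 : right_id pa_one pa_mul.
Proof.
apply: (freemod_ext (f := pa_rmul pa_one) (h := idfun)) => p /=.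
rewrite -/(pvec p) /pa_one -[LHS]/(pa_mul (pvec p) _) linear_sum /=.
rewrite (bigD1 (psrc p)) //= big1 ?addr0 => [|x /negPf xp].
  rewrite pa_mul_pvec /pvec_mul eqxx; congr pvec.
  by apply: val_inj; rewrite qcomp_val //= -surjective_pairing.
by rewrite pa_mul_pvec /pvec_mul eq_sym xp.
Qed.

Fact pa_mulDl : left_distributive pa_mul +%R.
Proof. by move=> a b c; apply: (linearD (pa_rmul c)). Qed.
Fact pa_mulDr : right_distributive pa_mul +%R.
Proof. by move=> a b c; apply: (linearD (pa_mul a)). Qed.
HB.instance Definition _ := GRing.Zmodule_isPzRing.Build A
  pa_mulA pa_mul1 pa_mulr1 pa_mulDl pa_mulDr.

Lemma pa_scalerAl x a b : x *: (a * b) = (x *: a) * b.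
Proof. by rewrite -[RHS]/((pa_rmul b) _) linearZ. Qed.
Lemma pa_scalerAr x a b : x *: (a * b) = a * (x *: b).
Proof. by rewrite -[RHS]/(pa_mul a _) linearZ. Qed.

Definition pa_const (x : k) : A := x *: (1 : A).

Lemma pa_constC x a : pa_const x * a = a * pa_const x.
Proof. by rewrite -pa_scalerAl -pa_scalerAr mul1r mulr1. Qed.
Lemma pa_constM x y : pa_const (x * y) = pa_const x * pa_const y.
Proof. by rewrite -pa_scalerAl mul1r /pa_const scalerA. Qed.
End PathAlgebra.

Section Modules.
Variables (k : fieldType) (Q : quiver).
Local Notation A := (path_alg k Q).

Section Scalars.
Variable M : lmodType A.

Definition kact (x : k) (m : M) : M := pa_const Q x *: m.
Fact kact_linear x : linear (kact x).
Proof.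
by move=> a u v; rewrite /kact scalerDr !scalerA pa_constC.
Qed.
HB.instance Definition _ x := GRing.isLinear.Build A M M *:%R (kact x)
  (kact_linear x).

Fact kactA x y m : kact x (kact y m) = kact (x * y) m.
Proof. by rewrite /kact scalerA pa_constM. Qed.
Fact kact1 m : kact 1 m = m.
Proof. by rewrite /kact /pa_const !scale1r. Qed.
Fact kactDl x y m : kact (x + y) m = kact x m + kact y m.
Proof. by rewrite /kact /pa_const scalerDl scalerDl. Qed.

Definition kbimod : bimod A k :=
  @Bimod A k M (fun x => kact x) kactA kact1 kactDl.

Definition kvect : Type := M.
HB.instance Definition _ := GRing.Zmodule.on kvect.
HB.instance Definition _ := GRing.Zmodule_isLmodule.Build k kvect
  kactA kact1 (fun x => linearD (kact x)) (fun m x y => kactDl x y m).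
End Scalars.

Definition HomQ (M N : lmodType A) : lmodType k := homs M (kbimod N).
Definition ExtQ (M N : lmodType A) : lmodType k := ext M (kbimod N).
Definition HomQ_id (M : lmodType A) : HomQ M M := idfun : {linear M -> M}.

Definition fin_gen (M : lmodType A) : Prop :=
  exists (n : nat) (x : 'I_n -> M),
    forall m, exists a : 'I_n -> A, m = \sum_i a i *: x i.

Definition fin_dim (V : lmodType k) : Prop :=
  exists (n : nat) (x : 'I_n -> V),
    forall v, exists c : 'I_n -> k, v = \sum_i c i *: x i.

Definition hom_finite (E : lmodType A) : Prop :=
  forall N : lmodType A, fin_gen N ->
    [/\ fin_dim (HomQ E N), fin_dim (ExtQ E N),
        fin_dim (HomQ N E) & fin_dim (ExtQ N E)].

(* Hom-finiteness is part of the notion of an exceptional module. *)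
Definition exceptional (E : lmodType A) : Prop :=
  let id0 : HomQ E E * ExtQ E E := (HomQ_id E, 0) in
  [/\ id0 != 0,
      forall v : HomQ E E * ExtQ E E, exists c : k, v = c *: id0
    & hom_finite E].

Definition injective_module (E : lmodType A) : Prop :=
  forall (M N : lmodType A) (u : {linear M -> N}) (f : {linear M -> E}),
    injective u -> exists g : {linear N -> E}, forall x, g (u x) = f x.

(* The vertex is a phantom argument selecting the module structure. *)
Definition simple_sort (i : Q) : Type := k.
HB.instance Definition _ i := GRing.Zmodule.on (simple_sort i).

Section Simple.
Variable i : Q.

(* [kQ] acts on [S_i] through the coefficient of the trivial path at [i]. *)
Definition aug (a : A) : k := fcoef (ptriv i) a.

Lemma augM : {morph aug : a b / a * b}.
Proof.
move=> a b.
have aug_pvec p : aug (pvec k p) = (p == ptriv i)%:R by apply: fcoef_basis.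
have augP x u v : aug (x *: u + v) = x * aug u + aug v by exact: linearP.
pose f1 (c : freemod k (qpath Q)) : k^o := aug ((c : A) * b).
pose h1 (c : freemod k (qpath Q)) : k^o := aug c * aug b.
suff /(_ a) : f1 =1 h1 by [].
apply: freemod_extP => [x u v|x u v|p].
- by rewrite /f1 -[RHS]augP; congr aug; apply: (linearP (pa_rmul b)).
- by rewrite /h1 augP mulrDl -mulrA.
pose f2 (c : freemod k (qpath Q)) : k^o := aug (pvec k p * (c : A)).
pose h2 (c : freemod k (qpath Q)) : k^o := aug (pvec k p) * aug c.
suff /(_ b) : f2 =1 h2 by [].
apply: freemod_extP => [x u v|x u v|q].
- by rewrite /f2 -[RHS]augP; congr aug; apply: (linearP (pa_mul _)).
- by rewrite /h2 augP mulrDr mulrCA.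
rewrite /f2 /h2 -[fbasis k q]/(pvec k q) [pvec k p * _]pa_mul_pvec.
rewrite !aug_pvec /pvec_mul -natrM mulnb.
case: eqP => [pq|npq]; last first.
  rewrite /aug linear0; case: eqP => //= pi; case: eqP => //= qi.
  by case: npq; rewrite pi qi.
by rewrite aug_pvec qcomp_triv.
Qed.

Lemma aug1 : aug 1 = 1.
Proof.
rewrite /aug -[1 in LHS]/(pa_one k Q) linear_sum /= (bigD1 i) //=.
rewrite big1 => [|x xi]; first by rewrite addr0 fcoef_basis eqxx.
by rewrite fcoef_basis -val_eqE /= xpair_eqE (negPf xi).
Qed.

Definition simple_scale (a : A) (x : simple_sort i) : simple_sort i :=
  (aug a * x : k).
Fact simple_scaleA a b x :
  simple_scale a (simple_scale b x) = simple_scale (a * b) x.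
Proof. by rewrite /simple_scale augM mulrA. Qed.
Fact simple_scale1 : left_id 1 simple_scale.
Proof. by move=> x; rewrite /simple_scale aug1 mul1r. Qed.
Fact simple_scaleDr : right_distributive simple_scale +%R.
Proof. by move=> a x y; apply: mulrDr. Qed.
Fact simple_scaleDl x : {morph simple_scale^~ x : a b / a + b}.
Proof. by move=> a b; rewrite /simple_scale /aug linearD; apply: mulrDl. Qed.
HB.instance Definition _ := GRing.Zmodule_isLmodule.Build A
  (simple_sort i) simple_scaleA simple_scale1 simple_scaleDr simple_scaleDl.
Definition simple_module : lmodType A := simple_sort i.

(* [kQ e_i], as a submodule of the left regular module. *)
Definition proj_pred : pred A^o :=
  fun x => (x : A) * pvec k (ptriv i) == (x : A).
Fact proj_pred_closed : subsemimod_closed proj_pred.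
Proof.
split; first split.
- by rewrite unfold_in /proj_pred mul0r.
- move=> x y; rewrite !unfold_in /proj_pred => /eqP xe /eqP ye.
  by rewrite [X in X == _](mulrDl (x : A) y) xe ye.
move=> a x; rewrite !unfold_in /proj_pred => /eqP xe.
by rewrite -[_ *: x]/(a * (x : A)) -mulrA xe.
Qed.
Definition proj_sort : Type := {x | proj_pred x}.
HB.instance Definition _ := SubChoice.on proj_sort.
HB.instance Definition _ := GRing.SubChoice_isSubLmodule.Build A A^o proj_pred
  proj_sort proj_pred_closed.
Definition proj_module : lmodType A := proj_sort.
End Simple.

(* [D M = Hom_k(M, k)], as a right [A]-module, i.e. a left [A^c]-module. *)
Definition dual (M : lmodType A) : Type := {linear kvect M -> k^o}.

Definition kmul (x : k) : k^o -> k^o := fun y => x * y.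
Fact kmul_linear x : linear (kmul x).
Proof. by move=> a u v; rewrite /kmul mulrDr mulrCA. Qed.
HB.instance Definition _ x := GRing.isLinear.Build k k^o k^o *:%R
  (kmul x) (kmul_linear x).
Definition kreg : bimod k k :=
  @Bimod k k k^o (fun x => kmul x) (@mulrA k) (@mul1r k) (@mulrDl k).

Section Dual.
Variable M : lmodType A.

HB.instance Definition _ := Choice.copy (dual M) (homs (kvect M) kreg).
HB.instance Definition _ := GRing.Zmodule.copy (dual M) (homs (kvect M) kreg).

Definition amul (a : A) : kvect M -> kvect M := fun m => a *: (m : M).
Fact amul_linear a : linear (amul a).
Proof.
move=> x u v; rewrite /amul scalerDr; congr (_ + _).
rewrite -[x *: u]/(pa_const Q x *: (u : M)) scalerA -pa_constC -scalerA.
by [].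
Qed.
HB.instance Definition _ a := GRing.isLinear.Build k (kvect M) (kvect M) *:%R
  (amul a) (amul_linear a).

Definition dual_scale (a : A^c) (f : dual M) : dual M :=
  (f : {linear kvect M -> k^o}) \o amul a.
Fact dual_scaleA (a b : A^c) f :
  dual_scale a (dual_scale b f) = dual_scale (a * b) f.
Proof. by apply: linear_eq => m /=; rewrite /amul scalerA. Qed.
Fact dual_scale1 : left_id 1 dual_scale.
Proof. by move=> f; apply: linear_eq => m /=; rewrite /amul scale1r. Qed.
Fact dual_scaleDr : right_distributive dual_scale +%R.
Proof. by move=> a f g; apply: linear_eq. Qed.
Fact dual_scaleDl f : {morph dual_scale^~ f : a b / a + b}.
Proof.
move=> a b; apply: linear_eq => m /=; rewrite -linearD.
by congr (f _); apply: (scalerDl (m : M) (a : A) (b : A)).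
Qed.
HB.instance Definition _ := GRing.Zmodule_isLmodule.Build A^c (dual M)
  dual_scaleA dual_scale1 dual_scaleDr dual_scaleDl.
End Dual.

(* The bimodule [A], as a right module with a commuting left action. *)
Definition lmulA (a : A) : (A^c)^o -> (A^c)^o := fun x => a * (x : A).
Fact lmulA_linear a : linear (lmulA a).
Proof.
move=> b x y; rewrite /lmulA -[b *: x]/((x : A) * (b : A)).
by rewrite -[RHS]/((a * (x : A)) * (b : A) + a * (y : A)) -mulrA -mulrDr.
Qed.
HB.instance Definition _ a := GRing.isLinear.Build A^c (A^c)^o (A^c)^o *:%R
  (lmulA a) (lmulA_linear a).
Definition areg : bimod A^c A :=
  @Bimod A^c A (A^c)^o (fun a => lmulA a) (@mulrA A) (@mul1r A) (@mulrDl A).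

(* For finite-dimensional [M]. As [A] is hereditary, the transpose of a right
   module [X] is [Ext^1(X, A)], so that [tau^-1 M = Tr (D M) = Ext^1_{A^op}(D M, A)]; this
   does not refer to minimal projective presentations, which need not exist
   when [Q] has oriented cycles. *)
Definition tau_inv (M : lmodType A) : lmodType A := ext (dual M) areg.
End Modules.

Record category := Category {
  obj :> Type;
  hom : obj -> obj -> Type;
  idm : forall x, hom x x;
  compm : forall x y z, hom y z -> hom x y -> hom x z;
  compA : forall w x y z (f : hom y z) (g : hom x y) (h : hom w x),
    compm f (compm g h) = compm (compm f g) h;
  comp1m : forall x y (f : hom x y), compm (idm y) f = f;
  compm1 : forall x y (f : hom x y), compm f (idm x) = f
}.
Arguments idm {c} x.
Arguments compm {c x y z} _ _.

Record functor (C D : category) := Functor {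
  fobj :> C -> D;
  fmor : forall x y : C, hom x y -> hom (fobj x) (fobj y);
  fmor_id : forall x : C, fmor (idm x) = idm (fobj x);
  fmor_comp : forall (x y z : C) (f : hom y z) (g : hom x y),
    fmor (compm f g) = compm (fmor f) (fmor g)
}.
Arguments fmor {C D} _ {x y} _.

Definition functor_id (C : category) : functor C C :=
  @Functor C C id (fun x y f => f) (fun x => erefl) (fun x y z f g => erefl).

Definition functor_comp (C D E : category) (G : functor D E) (F : functor C D) :
  functor C E.
Proof.
refine (@Functor C E (fun x => G (F x)) (fun x y f => fmor G (fmor F f)) _ _).
- by move=> x; rewrite !fmor_id.
- by move=> x y z f g; rewrite !fmor_comp.
Defined.
Notation "G \oF F" := (functor_comp G F).

Definition isomorphism (C : category) (x y : C) (f : hom x y) : Prop :=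
  exists2 g : hom y x, compm g f = idm x & compm f g = idm y.

Definition nat_isomorphic (C D : category) (F G : functor C D) : Prop :=
  exists eta : forall x : C, hom (F x) (G x),
    (forall x, isomorphism (eta x)) /\
    (forall (x y : C) (f : hom x y),
       compm (eta y) (fmor F f) = compm (fmor G f) (eta x)).

Definition equivalence (C D : category) (F : functor C D) : Prop :=
  exists G : functor D C,
    nat_isomorphic (G \oF F) (functor_id C) /\
    nat_isomorphic (F \oF G) (functor_id D).

Definition left_adjoint (C D : category) (L : functor C D) (R : functor D C) :
  Prop :=
  exists phi : forall (x : C) (y : D), hom (L x) y -> hom x (R y),
    (forall x y, bijective (phi x y)) /\
    (forall (x x' : C) (y y' : D) (f : hom x' x) (g : hom y y')
            (u : hom (L x) y),
       phi x' y' (compm g (compm u (fmor L f))) =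
       compm (fmor R g) (compm (phi x y u) f)).

Section FullSubcategory.
Variables (C : category) (P : C -> Prop).

Definition full_subcat : category :=
  @Category {x : C | P x} (fun x y => hom (sval x) (sval y))
    (fun x => idm (sval x)) (fun x y z f g => compm f g)
    (fun w x y z f g h => compA f g h) (fun x y f => comp1m f)
    (fun x y f => compm1 f).

Definition full_incl : functor full_subcat C :=
  @Functor full_subcat C (fun x => sval x) (fun x y f => f)
    (fun x => erefl) (fun x y z f g => erefl).
End FullSubcategory.

Section Perpendicular.
Variables (k : fieldType) (Q : quiver).
Local Notation A := (path_alg k Q).

Definition ModQ : category.
Proof.
refine (@Category {M : lmodType A | fin_gen M}
  (fun M N => {linear sval M -> sval N}) (fun M => idfun)
  (fun L M N f g => f \o g) _ _ _).
- by move=> L M N P f g h; apply: linear_eq.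
- by move=> M N f; apply: linear_eq.
- by move=> M N f; apply: linear_eq.
Defined.

Definition in_perp (E : lmodType A) (N : ModQ) : Prop :=
  (forall f : HomQ E (sval N), f = 0) /\ (forall e : ExtQ E (sval N), e = 0).

Definition perp (E : lmodType A) : category := full_subcat (in_perp E).
Definition perp_incl (E : lmodType A) : functor (perp E) ModQ :=
  full_incl (in_perp E).

Definition partner (i : Q) : lmodType A :=
  if `[< injective_module (simple_module k i) >]
  then proj_module k i else tau_inv (simple_module k i).
End Perpendicular.

(* Main.v *)
(* The simple module is [S = A / K], where [K] is the two-sided ideal spanned by
   the paths other than the trivial path at [i]. As [K] is left projective,
   [N] lies in the right perpendicular category of [S] iff [N -> Hom_A(K, N)]
   is bijective, and [Hom_A(K, N)] is the reflection of [N]: its component at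
   [i] is the sum of the [N_(tgt a)] over the arrows [a] out of [i], its other
   components are those of [N]. Dually, whether [F = P_i] or
   [F = tau^-1 S = Ext^1(DS, A) = Hom(K, A) / A], a module [N] lies in the
   perpendicular category of [F] iff [K (x) N -> N] is bijective, where
   [K (x) N] has the sum of the [N_(src b)] over the arrows [b] into [i] as its
   component at [i]. As [S] has no self-extension, there is no loop at [i] and
   [K (x) K = K], so that [Hom_A(K, -)] and [K (x) -] restrict to mutually
   inverse equivalences between the two perpendicular categories. *)
From HB Require Import structures.
Require Import Defs.
From mathcomp Require Import all_boot all_algebra.
From mathcomp Require Import boolp.
From mathcomp Require classical_sets.

Set Implicit Arguments.
Unset Strict Implicit.
Unset Printing Implicit Defensive.

Import GRing.Theory.
Local Open Scope ring_scope.

(** * Fox derivatives on the path algebra *)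

Section FoxCalculus.
Variables (k : fieldType) (Q : quiver).
Local Notation A := (path_alg k Q).
Local Notation pv p := (pvec k p : A).
Implicit Types (p q : qpath Q) (x y : A) (a b : arr Q) (i j : Q).

(** The maps [N -> Hom_A(K, N)] and [K (x) N -> N] have kernels and cokernels annihilated by [K],
    and the two functors do not see such modules because [K = K K]. The last fact is made explicit:
    every [z] in [K] is a finite sum of products [u_l(z) v_l], with [u_l : K -> K] left linear and
    [v_l] in [K]. Beside the [z e_j], the coordinates [u_l(z)] are Fox derivatives along the arrows
    [a] out of [i]; they lie in [A e_(tgt a)], hence in [K] once [tgt a] differs from [i]. This one
    formula yields all the statements about [K (x) K]. The derivatives on the other side describe
    [K] as a right module, which gives both the model of [K (x) N] and the presentation of
    [tau^-1 S]. Since [A] may be infinite-dimensional, finite generation of [Hom_A(K, N)] needs an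
    argument: the cokernel of [N] in it is [Ext(S, N)], finite-dimensional because [S] is
    Hom-finite. *)

Definition idem i : A := pvec k (ptriv i).

Definition arr_path a : qpath Q := insubd (ptriv (src a)) (src a, [:: a]).
Definition arrow a : A := pvec k (arr_path a).

Lemma arr_pathE a : val (arr_path a) = (src a, [:: a]).
Proof. by rewrite insubdK // unfold_in /= eqxx. Qed.

Lemma psrc_arr a : psrc (arr_path a) = src a.
Proof. by rewrite /psrc arr_pathE. Qed.

Lemma ptgt_arr a : ptgt (arr_path a) = tgt a.
Proof. by rewrite /ptgt arr_pathE. Qed.

Lemma qpath_nilE p : p.2 = [::] -> p = ptriv (psrc p).
Proof. by case: p => -[u s] w /= s0; apply/val_inj/(congr1 (pair u) s0). Qed.

Lemma pvecM p q :
  pv p * pv q = if psrc p == ptgt q then pv (qcomp p q) else 0.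
Proof. exact: pa_mul_pvec. Qed.

Lemma pvec_idem p j : pv p * idem j = (psrc p == j)%:R *: pv p.
Proof.
rewrite pvecM -[ptgt (ptriv j)]/j; case: eqP => [pj|]; last by rewrite scale0r.
rewrite scale1r; congr pvec; apply: val_inj; rewrite qcomp_val //= -pj.
by rewrite /psrc; case: (val p).
Qed.

Lemma idem_pvec p j : idem j * pv p = (ptgt p == j)%:R *: pv p.
Proof.
rewrite pvecM -[psrc (ptriv j)]/j eq_sym.
case: eqP => [pj|]; last by rewrite scale0r.
by rewrite scale1r; congr pvec; apply: val_inj; rewrite qcomp_val //= cats0;
  case: (val p).
Qed.

Lemma aug_pvec i p : aug i (pv p) = (p == ptriv i)%:R.
Proof. exact: fcoef_basis. Qed.

Lemma augD i x y : aug i (x + y) = aug i x + aug i y.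
Proof. exact: (linearD (fcoef (R := k) (ptriv i))). Qed.

Lemma aug0 i : aug i (0 : A) = 0.
Proof. exact: (linear0 (fcoef (R := k) (ptriv i))). Qed.

Lemma augN i x : aug i (- x) = - aug i x.
Proof. exact: (linearN (fcoef (R := k) (ptriv i))). Qed.

Lemma augZ i c x : aug i (c *: x) = c * aug i x.
Proof. by rewrite /aug linearZ. Qed.

Lemma idemM i j : idem i * idem j = (i == j)%:R *: idem i.
Proof. exact: pvec_idem. Qed.

Lemma idem_idem j : idem j * idem j = idem j.
Proof. by rewrite idemM eqxx scale1r. Qed.

Lemma aug_idem i j : aug i (idem j) = (j == i)%:R.
Proof. by rewrite aug_pvec -val_eqE /= xpair_eqE andbT. Qed.

Lemma aug_arrow i a : aug i (arrow a) = 0.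
Proof. by rewrite aug_pvec -val_eqE arr_pathE xpair_eqE andbF. Qed.

Lemma sum_idem : \sum_j idem j = 1.
Proof. by []. Qed.

Lemma pa_ext (W : lmodType k) (f g : A -> W) : linear f -> linear g ->
  (forall p, f (pv p) = g (pv p)) -> f =1 g.
Proof. exact: freemod_extP. Qed.

Lemma pa_ext2 (W : lmodType k) (f g : A -> A -> W) :
    (forall y, linear (f^~ y)) -> (forall x, linear (f x)) ->
    (forall y, linear (g^~ y)) -> (forall x, linear (g x)) ->
    (forall p q, f (pv p) (pv q) = g (pv p) (pv q)) ->
  forall x y, f x y = g x y.
Proof.
move=> fl fr gl gr fg x y; apply: (pa_ext (fr x) (gr x)) => q.
by apply: (pa_ext (fl (pv q)) (gl (pv q))) => p.
Qed.

Fact mulrA_linear x : linear (fun y : A => x * y).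
Proof. by move=> c u v; rewrite mulrDr pa_scalerAr. Qed.
Fact mulAl_linear y : linear (fun x : A => x * y).
Proof. by move=> c u v; rewrite mulrDl pa_scalerAl. Qed.

(* [lfox a] and [rfox a] are the left and right Fox derivatives along the arrow
   [a]: on a path they strip [a] when it is the first (resp. last) arrow
   traversed, and they vanish otherwise. *)
Definition lfox_path a p : A :=
  if p.2 is b :: s then
    if b == a then pvec k (insubd (ptriv (tgt a)) (tgt a, s)) else 0
  else 0.
Definition lfox a : A -> A := lin_ext (lfox_path a).

Definition rfox_path a p : A :=
  if rev p.2 is b :: s then
    if b == a then pvec k (insubd (ptriv p.1) (p.1, rev s)) else 0
  else 0.
Definition rfox a : A -> A := lin_ext (rfox_path a).

Fact lfox_linear a : linear (lfox a).
Proof. exact: (linearP (lin_ext (lfox_path a))). Qed.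
Fact rfox_linear a : linear (rfox a).
Proof. exact: (linearP (lin_ext (rfox_path a))). Qed.

HB.instance Definition _ a := GRing.isLinear.Build k A A *:%R (lfox a)
  (lfox_linear a).
HB.instance Definition _ a := GRing.isLinear.Build k A A *:%R (rfox a)
  (rfox_linear a).

Lemma lfox_pvec a p : lfox a (pv p) = lfox_path a p.
Proof. exact: lin_ext_basis. Qed.
Lemma rfox_pvec a p : rfox a (pv p) = rfox_path a p.
Proof. exact: lin_ext_basis. Qed.

Lemma lfox_nil a p : p.2 = [::] -> lfox a (pv p) = 0.
Proof. by rewrite lfox_pvec /lfox_path => ->. Qed.
Lemma rfox_nil a p : p.2 = [::] -> rfox a (pv p) = 0.
Proof. by rewrite rfox_pvec /rfox_path => ->. Qed.

Lemma lfox_src a p : psrc p != src a -> lfox a (pv p) = 0.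
Proof.
rewrite lfox_pvec /lfox_path /psrc; case: p => -[u [|b s]] //= /andP[/eqP <- _].
by case: (eqVneq b a) => // ->; rewrite eqxx.
Qed.

Lemma lfox_cons a p b s : p.2 = b :: s ->
  exists2 q, val q = (tgt b, s) & lfox a (pv p) = (b == a)%:R *: pv q.
Proof.
move=> ps; have /= := valP p; rewrite ps /= => /andP[_ w].
exists (@QPath _ (tgt b, s) w) => //.
rewrite lfox_pvec /lfox_path ps; case: eqP => [<-|]; last by rewrite scale0r.
by rewrite scale1r; congr pvec; apply: val_inj; rewrite insubdK.
Qed.

Lemma rfox_rcons a p b s : p.2 = rcons s b ->
  exists q, [/\ val q = (psrc p, s), ptgt q = src b
    & rfox a (pv p) = (b == a)%:R *: pv q].
Proof.
move=> ps; have /= := valP p; rewrite ps /= -cats1 walk_cat => /andP[w /= wb].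
exists (@QPath _ (psrc p, s) w); split=> //.
  by rewrite /ptgt /=; case/andP: wb => /eqP->.
rewrite rfox_pvec /rfox_path ps rev_rcons revK.
case: eqP => _; last by rewrite scale0r.
by rewrite scale1r; congr pvec; apply: val_inj; rewrite insubdK.
Qed.

Lemma ptgt_rcons p b s : p.2 = rcons s b -> ptgt p = tgt b.
Proof. by move=> ps; rewrite /ptgt ps /walk_end map_rcons last_rcons. Qed.

Lemma qpath_lastP p : p.2 = [::] \/ exists b s, p.2 = rcons s b.
Proof. by case/lastP: p.2 => [|s b]; [left | right; exists b, s]. Qed.

Lemma rfox_tgt a p : ptgt p != tgt a -> rfox a (pv p) = 0.
Proof.
case: (qpath_lastP p) => [ps|[b [s ps]]]; first by rewrite rfox_nil.
rewrite (ptgt_rcons ps) => ba; have [q [_ _ ->]] := rfox_rcons a ps.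
by case: (eqVneq b a) ba => [->|_ _]; rewrite ?eqxx // scale0r.
Qed.

(** In [x * y] the path [y] is traversed first, so it owns the first arrow unless it is trivial. A
    trivial [y] leaves [x] or 0, and only a path [x] starting at [src a] has a nonzero derivative,
    whence the augmentation at [src a]. *)
Lemma lfoxM a x y : lfox a (x * y) = x * lfox a y + aug (src a) y *: lfox a x.
Proof.
apply: (pa_ext2 (f := fun x y => lfox a (x * y))
  (g := fun x y => x * lfox a y + aug (src a) y *: lfox a x)) x y.
- by move=> y c u v; rewrite mulAl_linear linearP.
- by move=> x c u v; rewrite mulrA_linear linearP.
- move=> y c u v; rewrite mulAl_linear linearP /= !scalerDr addrACA.
  by rewrite !scalerA [_ * c]mulrC.
- move=> x c u v; rewrite linearP /= mulrA_linear scalerDr addrACA augD augZ.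
  by rewrite scalerDl scalerA.
move=> p q; rewrite aug_pvec.
case qs: q.2 => [|b s].
  rewrite [X in _ = _ * X + _](lfox_nil a qs) mulr0 add0r (qpath_nilE qs).
  rewrite -/(idem _) pvec_idem linearZ /= -val_eqE /= xpair_eqE andbT.
  have [pa|/lfox_src->] := eqVneq (psrc p) (src a); last by rewrite !scaler0.
  by rewrite pa eq_sym.
have [r rs rE] := lfox_cons a qs; rewrite [X in _ = _ * X + _]rE {rE}.
have -> : (q == ptriv (src a)) = false.
  by apply/eqP => qa; rewrite qa in qs.
have rq : ptgt r = ptgt q.
  by rewrite /ptgt rs qs.
rewrite scale0r addr0 pvecM -pa_scalerAr pvecM rq.
case: eqP => [pq|]; last by rewrite linear0 scaler0.
have [t ts ->] := lfox_cons a (p := qcomp p q) (b := b) (s := s ++ p.2)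
   ltac:(by rewrite qcomp_val // qs).
congr (_ *: pvec k _); apply: val_inj.
by rewrite qcomp_val ?rq // ts rs.
Qed.

Lemma rfoxM a x y : rfox a (x * y) = rfox a x * y + aug (tgt a) x *: rfox a y.
Proof.
apply: (pa_ext2 (f := fun x y => rfox a (x * y))
  (g := fun x y => rfox a x * y + aug (tgt a) x *: rfox a y)) x y.
- by move=> y c u v; rewrite mulAl_linear linearP.
- by move=> x c u v; rewrite mulrA_linear linearP.
- move=> y c u v; rewrite linearP /= mulAl_linear scalerDr addrACA augD augZ.
  by rewrite scalerDl scalerA.
- move=> x c u v; rewrite linearP /= mulrA_linear !scalerDr addrACA.
  by rewrite !scalerA [_ * c]mulrC.
move=> p q; rewrite aug_pvec.
case: (qpath_lastP p) => [ps|[b [s ps]]].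
  rewrite [X in _ = X * _ + _](rfox_nil a ps) mul0r add0r (qpath_nilE ps).
  rewrite -/(idem _) idem_pvec linearZ /= -val_eqE /= xpair_eqE andbT.
  have [qa|/rfox_tgt->] := eqVneq (ptgt q) (tgt a); last by rewrite !scaler0.
  by rewrite qa eq_sym.
have [r [rs rb rE]] := rfox_rcons a ps; rewrite [X in _ = X * _ + _]rE {rE}.
have -> : (p == ptriv (tgt a)) = false.
  by apply/eqP => qa; rewrite qa in ps; case: s ps {rs}.
have rp : psrc r = psrc p.
  by rewrite /psrc rs.
rewrite scale0r addr0 pvecM -pa_scalerAl pvecM rp.
case: eqP => [pq|]; last by rewrite linear0 scaler0.
have [t [ts _ ->]] := rfox_rcons a (p := qcomp p q) (b := b) (s := q.2 ++ s)
   ltac:(by rewrite qcomp_val //= ps rcons_cat).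
congr (_ *: pvec k _); apply: val_inj.
by rewrite qcomp_val ?rp // ts rs psrc_comp.
Qed.

Lemma rfox_idem a j : rfox a (idem j) = 0.
Proof. exact: rfox_nil. Qed.

Lemma lfox_arrow a b : lfox a (arrow b) = (b == a)%:R *: idem (tgt b).
Proof.
have [q qs ->] := @lfox_cons a (arr_path b) b [::] ltac:(by rewrite arr_pathE).
by congr (_ *: pvec k _); apply: val_inj; rewrite qs.
Qed.

Lemma rfox_arrow a b : rfox a (arrow b) = (b == a)%:R *: idem (src b).
Proof.
have [q [qs _ ->]] := @rfox_rcons a (arr_path b) b [::]
  ltac:(by rewrite arr_pathE).
by congr (_ *: pvec k _); apply: val_inj; rewrite qs psrc_arr.
Qed.

Lemma rfox1 a : rfox a 1 = 0.
Proof. by rewrite -sum_idem linear_sum big1 // => j _; rewrite /= rfox_idem. Qed.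

Lemma lfox_tgt a x : lfox a x * idem (tgt a) = lfox a x.
Proof.
apply: (pa_ext (f := fun x => lfox a x * idem (tgt a))) => [c u v|c u v|p].
- by rewrite linearP mulAl_linear.
- exact: linearP.
case ps: p.2 => [|b s]; first by rewrite lfox_nil ?mul0r.
have [q qs ->] := lfox_cons a ps; rewrite -pa_scalerAl pvec_idem /psrc qs /=.
by case: eqP => [->|]; rewrite ?scale0r // eqxx !scale1r.
Qed.

Lemma idem_rfox a x : idem (src a) * rfox a x = rfox a x.
Proof.
apply: (pa_ext (f := fun x => idem (src a) * rfox a x)) => [c u v|c u v|p].
- by rewrite linearP mulrA_linear.
- exact: linearP.
case: (qpath_lastP p) => [ps|[b [s ps]]]; first by rewrite rfox_nil ?mulr0.
have [q [_ qs ->]] := rfox_rcons a ps; rewrite -pa_scalerAr idem_pvec qs.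
by case: eqP => [->|]; rewrite ?scale0r // eqxx !scale1r.
Qed.

Lemma arrow_idem a j : arrow a * idem j = (src a == j)%:R *: arrow a.
Proof. by rewrite pvec_idem psrc_arr. Qed.
Lemma idem_arrow a j : idem j * arrow a = (tgt a == j)%:R *: arrow a.
Proof. by rewrite idem_pvec ptgt_arr. Qed.

(** A nontrivial path factors uniquely through its first arrow, so the nontrivial paths span the
    direct sum of the left ideals [A a]; [lfox a] is the coordinate along [a]. Projectivity of [K]
    enters in this form. *)
Lemma lfox_sum x :
  x = \sum_j aug j x *: idem j + \sum_a lfox a x * arrow a.
Proof.
apply: (pa_ext (f := id) (g := fun x =>
  \sum_j aug j x *: idem j + \sum_a lfox a x * arrow a)) => // [c u v|p].
  rewrite scalerDr !scaler_sumr addrACA -!big_split; congr (_ + _).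
    by apply: eq_bigr => j _; rewrite /= augD augZ scalerDl scalerA.
  by apply: eq_bigr => a _; rewrite /= linearP mulAl_linear.
case ps: p.2 => [|b s].
  rewrite [X in _ + X]big1 ?addr0 => [|a _]; last by rewrite lfox_nil ?mul0r.
  rewrite (qpath_nilE ps) (bigD1 (psrc p)) //= big1 ?addr0 => [|j jp].
    by rewrite -/(idem _) aug_idem eqxx scale1r.
  by rewrite -/(idem _) aug_idem eq_sym (negPf jp) scale0r.
rewrite [X in X + _]big1 ?add0r => [|j _]; last first.
  by rewrite aug_pvec; case: eqP => [pj|_]; [rewrite pj in ps | rewrite scale0r].
rewrite (bigD1 b) //= big1 ?addr0 => [|a ab]; last first.
  have [q _ ->] := lfox_cons a ps.
  by rewrite eq_sym (negPf ab) scale0r mul0r.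
have [q qs ->] := lfox_cons b ps; rewrite eqxx scale1r pvecM ptgt_arr {1}/psrc qs.
rewrite eqxx; congr pvec; apply: val_inj.
rewrite qcomp_val ?arr_pathE ?qs; last by rewrite ptgt_arr /psrc qs.
have /= := valP p; rewrite ps /= => /andP[/eqP-> _].
by rewrite -ps; case: (val p).
Qed.

Lemma rfox_sum x :
  x = \sum_j aug j x *: idem j + \sum_a arrow a * rfox a x.
Proof.
apply: (pa_ext (f := id) (g := fun x =>
  \sum_j aug j x *: idem j + \sum_a arrow a * rfox a x)) => // [c u v|p].
  rewrite scalerDr !scaler_sumr addrACA -!big_split; congr (_ + _).
    by apply: eq_bigr => j _; rewrite /= augD augZ scalerDl scalerA.
  by apply: eq_bigr => a _; rewrite /= linearP mulrA_linear.
case: (qpath_lastP p) => [ps|[b [s ps]]].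
  rewrite [X in _ + X]big1 ?addr0 => [|a _]; last by rewrite rfox_nil ?mulr0.
  rewrite (qpath_nilE ps) (bigD1 (psrc p)) //= big1 ?addr0 => [|j jp].
    by rewrite -/(idem _) aug_idem eqxx scale1r.
  by rewrite -/(idem _) aug_idem eq_sym (negPf jp) scale0r.
rewrite [X in X + _]big1 ?add0r => [|j _]; last first.
  rewrite aug_pvec; case: eqP => [pj|_]; last by rewrite scale0r.
  by rewrite pj in ps; case: s ps.
rewrite (bigD1 b) //= big1 ?addr0 => [|a ab]; last first.
  have [q [_ _ ->]] := rfox_rcons a ps.
  by rewrite eq_sym (negPf ab) scale0r mulr0.
have [q [qs qt ->]] := rfox_rcons b ps.
rewrite eqxx scale1r pvecM psrc_arr qt eqxx; congr pvec; apply: val_inj.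
rewrite qcomp_val ?psrc_arr ?qt // arr_pathE qs /= cats1 -ps.
by rewrite /psrc; case: (val p).
Qed.

End FoxCalculus.

(** * Presentations and the Ext modules *)

Definition mk_linear (R : pzRingType) (M N : lmodType R) (f : M -> N)
  (lf : linear f) : {linear M -> N} :=
  HB.pack f (GRing.isLinear.Build R M N *:%R f lf).

Lemma linear_factor (R : pzRingType) (P M N : lmodType R)
    (q : {linear P -> M}) (h : {linear P -> N}) :
    (forall y, exists x, q x = y) -> (forall x, q x = 0 -> h x = 0) ->
  exists g : {linear M -> N}, forall x, g (q x) = h x.
Proof.
move=> /choice[s qs] qh.
have hE x y : q x = q y -> h x = h y.
  move=> e; apply/eqP; rewrite -subr_eq0 -linearB; apply/eqP/qh.
  by rewrite linearB e subrr.
have sl : linear (h \o s).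
  move=> a u v /=; rewrite -linearP; apply: hE.
  by rewrite linearP !qs.
by exists (mk_linear sl) => x /=; apply: hE; rewrite qs.
Qed.

Section Regular.
Variables (R : pzRingType) (M : lmodType R).

Definition reg_lift (m : M) : R^o -> M := fun x => (x : R) *: m.
Fact reg_lift_linear m : linear (reg_lift m).
Proof. by move=> c x y; rewrite /reg_lift scalerDl scalerA. Qed.
HB.instance Definition _ (m : M) := GRing.isLinear.Build R R^o M *:%R
  (reg_lift m) (reg_lift_linear m).

Lemma regular_linearE (h : {linear R^o -> M}) (x : R) : h x = x *: h 1.
Proof. by rewrite -linearZ; congr (h _); rewrite -[RHS]/(x * 1) mulr1. Qed.

Variable I : finType.

Definition ffun_lift (w : I -> M) (x : {ffun I -> R^o}) : M :=
  \sum_b (x b : R) *: w b.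
Fact ffun_lift_linear w : linear (ffun_lift w).
Proof.
move=> c x y; rewrite /ffun_lift scaler_sumr -big_split; apply: eq_bigr => b _.
by rewrite !ffunE scalerDl scalerA.
Qed.
HB.instance Definition _ w := GRing.isLinear.Build R {ffun I -> R^o} M *:%R
  (ffun_lift w) (ffun_lift_linear w).

Definition ffun_delta (b : I) : {ffun I -> R^o} := [ffun c => (c == b)%:R : R].

Lemma ffun_lift_delta w b : ffun_lift w (ffun_delta b) = w b.
Proof.
rewrite /ffun_lift (bigD1 b) //= big1 ?addr0 => [|c /negPf cb].
  by rewrite ffunE eqxx scale1r.
by rewrite ffunE cb scale0r.
Qed.

Lemma ffun_linearE (h : {linear {ffun I -> R^o} -> M}) x :
  h x = ffun_lift (h \o ffun_delta) x.
Proof.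
have {1}-> : x = \sum_b (x b : R) *: ffun_delta b.
  apply/ffunP => c; rewrite sum_ffunE (bigD1 c) //= big1 ?addr0 => [|b /negPf bc].
    by rewrite !ffunE eqxx; apply/esym/mulr1.
  by rewrite !ffunE eq_sym bc; apply/mulr0.
by rewrite linear_sum; apply: eq_bigr => b _; rewrite linearZ.
Qed.
End Regular.

Section KernelMaps.
Variables (R : pzRingType) (M : lmodType R).

Lemma kerP (P : lmodType R) (p : {linear P -> M}) (z : ker p) : p (val z) = 0.
Proof. exact/eqP/(valP z). Qed.

Definition mk_ker (P : lmodType R) (p : {linear P -> M}) x (px : p x = 0) :
  ker p := Sub x (introT eqP px).

Variables (P P' : lmodType R) (p : {linear P -> M}) (p' : {linear P' -> M}).
Variables (u : {linear P -> P'}) (pu : forall x, p' (u x) = p x).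

Definition ker_map (z : ker p) : ker p' :=
  mk_ker (etrans (pu (val z)) (kerP z)).
Fact ker_map_linear : linear ker_map.
Proof. by move=> a x y; apply: val_inj; rewrite /= !linearP. Qed.
HB.instance Definition _ := GRing.isLinear.Build R (ker p) (ker p') *:%R
  ker_map ker_map_linear.
End KernelMaps.

Lemma coker_pi_eq0 (R : pzRingType) (M N : lmodType R) (f : {linear M -> N}) y :
  coker_pi f y = 0 <-> exists x, f x = y.
Proof.
have pi0 : coker_pi f 0 = 0.
  by apply: (addrI (coker_pi f 0)); rewrite -coker_piD !addr0.
rewrite -pi0; split=> [/coker_piP[x fx]|[x fx]].
  by exists x; rewrite fx subr0.
by apply/coker_piP; exists x; rewrite subr0.
Qed.

Section ExtPresentation.
Variables (R B : pzRingType) (M P : lmodType R) (N : bimod R B).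
Variables (p : {linear P -> M}) (s : {linear P -> free_cover M}).
Variables (t : {linear free_cover M -> P}).
Hypothesis ps : forall x, cover_map M (s x) = p x.
Hypothesis pt : forall x, p (t x) = cover_map M x.

(** [ext] is built on the canonical free cover; this map computes it from another presentation [p].
    The lift [s] of [p] through the free cover stands for projectivity of [P]. *)
Definition ext_class : homs (ker p) N -> ext M N :=
  coker_pi (homs_pre (syz_incl M)) \o homs_pre (ker_map pt).

Fact ext_class_linear : linear ext_class.
Proof.
move=> a f g; rewrite /ext_class /= linearP coker_piD; congr (_ + _).
exact/esym/coker_scaleE.
Qed.
HB.instance Definition _ := GRing.isLinear.Build B (homs (ker p) N) (ext M N)
  *:%R ext_class ext_class_linear.

(* [s] and [t] are homotopy equivalences: [s \o t - id] and [t \o s - id] take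
   values in the kernels of the two presentations. *)
Lemma homotopy_syz (g : {linear syz M -> N}) :
  exists h : {linear free_cover M -> N}, forall w : syz M,
  g w = g (ker_map ps (ker_map pt w)) - h (val w).
Proof.
have st_ker x : cover_map M (s (t x) - x) = 0 by rewrite linearB ps pt subrr.
have dl : linear (fun x => mk_ker (st_ker x) : syz M).
  by move=> a x y; apply: val_inj; rewrite /= !linearP /= scalerDr addrACA.
exists (g \o mk_linear dl) => w /=; rewrite -linearB; congr (g _).
by apply: val_inj; rewrite /= subKr.
Qed.

Lemma homotopy_ker (f : {linear ker p -> N}) : exists h : {linear P -> N},
  forall z : ker p, f z = f (ker_map pt (ker_map ps z)) - h (val z).
Proof.
have ts_ker x : p (t (s x) - x) = 0 by rewrite linearB pt ps subrr.
have dl : linear (fun x => mk_ker (ts_ker x)).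
  by move=> a x y; apply: val_inj; rewrite /= !linearP /= scalerDr addrACA.
exists (f \o mk_linear dl) => w /=; rewrite -linearB; congr (f _).
by apply: val_inj; rewrite /= subKr.
Qed.

Lemma ext_class_surj e : exists f, ext_class f = e.
Proof.
rewrite -[e]coker_pi_repr; set g := repr _.
exists (homs_pre (ker_map ps) g); have [h gh] := homotopy_syz g.
apply/coker_piP; exists (h : homs _ _); apply: linear_eq => w /=.
by rewrite [g w]gh subKr.
Qed.

Lemma ext_class_eq0 (f : homs (ker p) N) :
  ext_class f = 0 <-> exists h : {linear P -> N},
    forall z, (f : {linear _ -> _}) z = h (val z).
Proof.
split=> [|[h fh]].
  move=> /(coker_pi_eq0 (homs_pre (syz_incl M)))[h0 e].
  have [h fh] := homotopy_ker f.
  have {}e w : (h0 : {linear _ -> _}) (val w) =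
      (f : {linear _ -> _}) (ker_map pt w).
    have := congr1 (fun u : homs (syz M) N => (u : {linear _ -> _}) w) e.
    by [].
  (* [h0 \o s] restricts to [f] pulled back along [t] and then [s]; the homotopy [h] accounts for
     the difference with [f]. *)
  exists (((h0 : {linear _ -> _}) \o s) \- h) => z /=.
  by rewrite fh -e.
apply/(coker_pi_eq0 (homs_pre (syz_incl M))).
exists ((h \o t : {linear _ -> _}) : homs _ _).
by apply: linear_eq => w /=; rewrite fh.
Qed.

Lemma ext_eq0P : (forall e : ext M N, e = 0) <->
  forall f : {linear ker p -> N}, exists h : {linear P -> N},
    forall z, f z = h (val z).
Proof.
split=> [e0 f|e0 e]; first exact/(ext_class_eq0 f)/e0.
by have [f <-] := ext_class_surj e; apply/ext_class_eq0/e0.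
Qed.
End ExtPresentation.

Lemma cover_lift (R : pzRingType) (M P : lmodType R) (p : {linear P -> M}) :
    (forall y, exists x, p x = y) ->
  exists t : {linear free_cover M -> P}, forall x, p (t x) = cover_map M x.
Proof.
move=> /choice[s ps]; exists (lin_ext s).
apply: (freemod_ext (f := p \o lin_ext s) (h := cover_map M)) => y /=.
by rewrite /cover_map !lin_ext_basis ps.
Qed.

(* The cokernel [F] of right multiplication by the [beta b], from [R] to the
   sum of the [R (sigma b)]. *)
Section RightMulCokernel.
Variables (R : pzRingType) (F : lmodType R) (I : finType).
Variables (beta sigma : I -> R).
Hypothesis beta_sigma : forall b, beta b * sigma b = beta b.
Hypothesis sigma_idem : forall b, sigma b * sigma b = sigma b.
Local Notation P0 := {ffun I -> R^o}.
Variable q : {linear P0 -> F}.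
Hypothesis qs : forall y, exists x, q x = y.
Hypothesis qk : forall x,
  q x = 0 <-> exists c, forall b, (x b : R) * sigma b = c * beta b.

(** [Hom(R (sigma b), X)] is [sigma b X], so a map from the cokernel is a family in these subgroups
    that is killed by the [beta b]. The sum of the [R (sigma b)] appears as a quotient of the free
    module [P0]: the condition [qk] with [c = 0] kills the complements. *)
Lemma Hom_cokernel_eq0 (X : lmodType R) :
  (forall (f : {linear F -> X}) y, f y = 0) <->
  forall nu : I -> X, (forall b, sigma b *: nu b = nu b) ->
    \sum_b beta b *: nu b = 0 -> forall b, nu b = 0.
Proof.
split=> [F0 nu nus nu0 b|nu_eq0 f y].
  have [|g gE] := linear_factor (h := ffun_lift nu) qs.
    move=> x /qk[c cE].
    apply: etrans (etrans _ (congr1 ( *:%R c) nu0)) (scaler0 _ c).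
    rewrite /= /ffun_lift scaler_sumr.
    by apply: eq_bigr => d _; rewrite -[in LHS]nus scalerA cE -scalerA.
  by rewrite -(ffun_lift_delta nu b) -gE F0.
have [x <-] := qs y; rewrite -[f _]/((f \o q) x) ffun_linearE.
rewrite /ffun_lift big1 // => b _; rewrite [X in _ *: X]nu_eq0 ?scaler0 //.
  move=> d /=; rewrite -!linearZ; apply/eqP; rewrite -subr_eq0 -!linearB.
  apply/eqP; rewrite (_ : q _ = 0) ?linear0 //; apply/qk; exists 0 => c.
  rewrite mul0r !ffunE -[X in X * _]/(sigma d * (c == d)%:R - (c == d)%:R).
  case: eqP => [->|_]; last by rewrite mulr0 subrr mul0r.
  by rewrite mulr1 mulrBl mul1r sigma_idem subrr.
transitivity ((f \o q) [ffun b => beta b]).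
  by rewrite ffun_linearE; apply: eq_bigr => d _; rewrite ffunE.
rewrite /= (_ : q _ = 0) ?linear0 //; apply/qk; exists 1 => c.
by rewrite ffunE beta_sigma mul1r.
Qed.

(** [divb] divides by [beta b0] on the right, so that right multiplication by the [beta b] is
    injective on [R e]. Thus [R e] resolves the cokernel, and [Ext(F, X)] is [e X] modulo the sum of
    the [beta b X]. *)
Lemma Ext_cokernel_eq0 (B : pzRingType) (X : bimod R B) (e : R) (b0 : I)
    (divb : R -> R) :
    (forall b, e * beta b = beta b) ->
    divb (beta b0) = e ->
    (forall a c d, divb (a * (c * beta b0) + d * beta b0) =
       a * divb (c * beta b0) + divb (d * beta b0)) ->
  (forall u : ext F X, u = 0) <->
  forall n : X, exists2 nu : I -> X, forall b, sigma b *: nu b = nu b &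
    e *: n = \sum_b beta b *: nu b.
Proof.
move=> e_beta divb_beta divb_linear.
pose s : {linear P0 -> free_cover F} :=
  ffun_lift (fun b => fbasis R (q (ffun_delta R b))).
have ps x : cover_map F (s x) = q x.
  rewrite [RHS]ffun_linearE /s /= /ffun_lift linear_sum; apply: eq_bigr => b _.
  by rewrite linearZ /= /cover_map lin_ext_basis.
have [t pt] := cover_lift qs; rewrite (ext_eq0P X ps pt).
pose kap : P0 := [ffun b => beta b].
have kap0 : q kap = 0 by apply/qk; exists 1 => b; rewrite ffunE beta_sigma mul1r.
split=> [ex n|surj g].
  (* An element of the kernel satisfies [x b * sigma b = c * beta b]; the division recovers [c * e]
     from the coordinate at [b0], so this map sends it to [c * e *: n]. *)
  have gl : linear (fun x : ker q => divb (((val x) b0 : R) * sigma b0) *: n).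
    move=> a x y; have /qk[c cE] := kerP x; have /qk[d dE] := kerP y.
    rewrite scalerA -scalerDl; congr (_ *: n); rewrite /= !ffunE.
    rewrite cE dE -divb_linear -cE -dE; congr divb.
    by rewrite mulrA -mulrDl.
  have [h hE] := ex (mk_linear gl).
  exists (fun b => sigma b *: h (ffun_delta R b)) => [b|].
    by rewrite scalerA sigma_idem.
  have := hE (mk_ker kap0); rewrite /= ffunE beta_sigma divb_beta => ->.
  rewrite ffun_linearE; apply: eq_bigr => b _.
  by rewrite ffunE scalerA beta_sigma.
have [nu nus nuE] := surj (g (mk_ker kap0)).
(* The kernel of [q] is generated by the [th b], which span the complements of the [R (sigma b)],
   and by [kap]. The extension takes [nu b] on [sigma b] and is corrected by the value of [g] at
   [th b]. *)
pose th b : P0 := ffun_delta R b - sigma b *: ffun_delta R b.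
have th0 b : q (th b) = 0.
  apply/qk; exists 0 => c; rewrite mul0r !ffunE.
  rewrite -[X in X * _]/((c == b)%:R - sigma b * (c == b)%:R).
  case: eqP => [->|_]; last by rewrite mulr0 subrr mul0r.
  by rewrite mulr1 mulrBl mul1r sigma_idem subrr.
exists (ffun_lift (fun b => nu b + g (mk_ker (th0 b)))) => x.
have /qk[c cE] := kerP x.
have kapE : mk_ker kap0 = e *: mk_ker kap0.
  by apply: val_inj; apply/ffunP => b; rewrite /= !ffunE; apply/esym/e_beta.
have xE : x = \sum_b ((val x) b : R) *: mk_ker (th0 b) + c *: mk_ker kap0.
  apply: val_inj; apply/ffunP => b; rewrite linearD linear_sum /= !ffunE sum_ffunE.
  rewrite (bigD1 b) //= big1 ?addr0 => [|d /negPf db].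
    rewrite !ffunE eqxx.
    rewrite -[RHS]/((sval x b : R) * (1 - sigma b * 1) + c * beta b).
    by rewrite -cE mulr1 mulrBr mulr1 subrK.
  rewrite !ffunE eq_sym db -[LHS]/((sval x d : R) * (0 - sigma d * 0)).
  by rewrite mulr0 subrr mulr0.
rewrite {1}xE linearD linear_sum linearZ /= kapE linearZ /= nuE scaler_sumr.
rewrite -big_split; apply: eq_bigr => b _; rewrite linearZ /= scalerDr addrC.
by congr (_ + _); rewrite scalerA -cE -scalerA nus.
Qed.
End RightMulCokernel.

(* A right ideal [J] of [R], given as the annihilator of a generator [m] of a
   right module, that is the sum of [(1 - e) R] and of the [beta b R], where
   [beta b R] is isomorphic to [sigma b R] through [fox b]. The module
   [Ext^1(m R, R)] is then the cokernel of right multiplication by the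
   [beta b], from [R] to the sum of the [R (sigma b)]. *)
Section RightExt.
Variables (R : pzRingType) (M : lmodType R^c) (m : M).
Hypothesis m_gen : forall y, exists x : R, (x : R^c) *: m = y.

Variable lact : R -> {linear (R^c)^o -> (R^c)^o}.
Hypothesis lactE : forall (a x : R), lact a x = a * x :> R.
Hypotheses (lactA : forall a b x, lact a (lact b x) = lact (a * b) x)
  (lact1 : forall x, lact 1 x = x)
  (lactD : forall a b x, lact (a + b) x = lact a x + lact b x).
Local Notation RR := (Bimod lactA lact1 lactD).
Local Notation F := (ext M RR).

Variables (I : finType) (e : R) (beta sigma : I -> R) (fox : I -> R -> R).
Local Notation ann z := ((z : R^c) *: m = 0).
Hypothesis e_ann : ann (1 - e).
Hypothesis beta_ann : forall b, ann (beta b).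
Hypothesis foxM : forall b (z c d : R), ann z ->
  fox b (z * c + d) = fox b z * c + fox b d.
Hypothesis fox_beta : forall b c, fox c (beta b) = if b == c then sigma b else 0.
Hypothesis sigma_fox : forall b (z : R), sigma b * fox b z = fox b z.
Hypothesis fox_sum : forall z : R, ann z -> e * z = \sum_b beta b * fox b z.

Local Notation P0 := {ffun I -> R^o}.
Let p : {linear (R^c)^o -> M} := reg_lift m.
Local Notation J := (ker p).

Fact right_cover x : cover_map M (reg_lift (fbasis R^c m) x) = p x.
Proof. by rewrite linearZ /= /cover_map lin_ext_basis. Qed.

Let comb (x : P0) (z : R) : R := \sum_b (x b : R) * fox b z.

Fact comb_linear x : linear (fun z : J => comb x (val z : R) : RR).
Proof.
move=> c y z.
transitivity (comb x ((val y : R) * (c : R) + (val z : R)) : R); first by [].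
rewrite -[RHS]/(comb x (val y : R) * (c : R) + comb x (val z : R)).
rewrite /comb mulr_suml -big_split; apply: eq_bigr => b _ /=.
by rewrite foxM ?mulrDr ?mulrA //; apply: kerP y.
Qed.

Definition comb_hom (x : P0) : homs J RR := mk_linear (comb_linear x).

Fact comb_hom_linear : linear comb_hom.
Proof.
move=> a x y; apply: linear_eq => z /=.
rewrite lactE -[RHS]/(a * comb x (val z : R) + comb y (val z : R)).
rewrite /comb mulr_sumr -big_split; apply: eq_bigr => b _ /=.
by rewrite !ffunE [LHS]mulrDl mulrA.
Qed.
HB.instance Definition _ := GRing.isLinear.Build R P0 (homs J RR) *:%R
  comb_hom comb_hom_linear.

Lemma comb_beta x b : comb x (beta b) = (x b : R) * sigma b.
Proof.
rewrite /comb (bigD1 b) //= fox_beta eqxx big1 ?addr0 // => c /negPf cb.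
by rewrite fox_beta eq_sym cb mulr0.
Qed.

(** [J] is generated by the [beta b] and [1 - e], so [f] is known from its values there. The term in
    [c = f (1 - e)] is a left multiplication; it extends to all of [R] and dies in Ext. *)
Lemma right_hom_split (f : {linear J -> RR}) :
  exists (x : P0) (c : R), forall z, f z = comb x (val z : R) + c * (val z : R).
Proof.
pose E : J := mk_ker (p := p) e_ann.
pose B b : J := mk_ker (p := p) (beta_ann b).
exists [ffun b => f (B b)], (f E) => z.
have zE : z = \sum_b ((fox b (val z : R) : R^c) *: B b) + ((val z : R) : R^c) *: E.
  have valE : (val z : R) = \sum_b beta b * fox b (val z) + (1 - e) * (val z : R).
    rewrite -fox_sum; last exact: kerP z.
    by rewrite -mulrDl addrC subrK mul1r.
  by apply: val_inj; rewrite linearD linear_sum.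
rewrite {1}zE linearD linear_sum; congr (_ + _); last by rewrite linearZ.
by apply: eq_bigr => b _; rewrite linearZ /= ffunE.
Qed.

Let p_surj : forall y, exists x, p x = y := m_gen.

Lemma right_ext_presentation : exists q : {linear P0 -> F},
  (forall y, exists x, q x = y) /\
  forall x, q x = 0 <-> exists c, forall b, (x b : R) * sigma b = c * beta b.
Proof.
have [t pt] := cover_lift p_surj.
pose cl : {linear homs J RR -> F} := @ext_class _ _ _ _ RR _ _ pt.
exists (cl \o comb_hom); split=> [y|x].
  have [f <-] := ext_class_surj right_cover pt y.
  have [x [c fE]] := right_hom_split f; exists x; apply/eqP.
  rewrite -subr_eq0 -[X in _ - X]/(cl f) /= -linearB.
  apply/eqP/(ext_class_eq0 right_cover); exists (reg_lift (- c : (R^c)^o)) => z.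
  rewrite /= fE -[reg_lift _ _]/(- c * (val z : R)) mulNr.
  by rewrite opprD addrA subrr add0r.
rewrite [_ = 0](ext_class_eq0 right_cover pt (comb_hom x)).
split=> [[h hE]|[c cE]].
  exists (h 1) => b; rewrite -comb_beta.
  apply: etrans (hE (mk_ker (p := p) (beta_ann b))) _.
  exact: regular_linearE.
(* The multiplier is [c * e] and not [c], because the sum of the [beta b * fox b z] recovers only
   [e * z]. *)
exists (reg_lift (c * e : (R^c)^o)) => z.
rewrite -[RHS]/(c * e * (val z : R)) -mulrA fox_sum; last exact: kerP z.
rewrite mulr_sumr.
by apply: eq_bigr => b _; rewrite mulrA -cE -mulrA sigma_fox.
Qed.

End RightExt.

Opaque lfox rfox lin_ext freemod_scale fbasis pvec pa_mul pa_one.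
Opaque idem arrow fcoef aug.

(** * The functor Hom(K, -) *)

Section Vertex.
Variables (k : fieldType) (Q : quiver) (i : Q).
Local Notation A := (path_alg k Q).
Local Notation S := (simple_module k i).
Implicit Types (a b : A) (j : Q).

Fact aug_map_linear : linear (aug i : A^o -> S).
Proof.
move=> a x y; rewrite augD; congr (_ + _).
exact: augM.
Qed.
HB.instance Definition _ := GRing.isLinear.Build A A^o S *:%R
  (aug i : A^o -> S) aug_map_linear.
Definition aug_map : {linear A^o -> S} := (aug i : A^o -> S).

Local Notation K := (ker aug_map).

Lemma aug_augK (z : K) : aug i (val z : A) = 0.
Proof. exact: kerP z. Qed.

Definition mkK (x : A) (x0 : aug i x = 0) : K := mk_ker (p := aug_map) x0.

Fact rmulK_subproof (a : A) (z : K) : aug i ((val z : A) * a) = 0.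
Proof. by rewrite augM aug_augK mul0r. Qed.
Definition rmulK (a : A) (z : K) : K := mkK (rmulK_subproof a z).
Fact rmulK_linear a : linear (rmulK a).
Proof.
move=> c x y; apply: val_inj => /=.
by rewrite [LHS](mulrDl (c * (val x : A))) -mulrA.
Qed.
HB.instance Definition _ a := GRing.isLinear.Build A K K *:%R (rmulK a)
  (rmulK_linear a).

Lemma rmulKA a b z : rmulK a (rmulK b z) = rmulK (b * a) z.
Proof. by apply: val_inj; rewrite /= mulrA. Qed.

Definition simple1 : S := (1 : k).

Lemma simple1Z a : a *: simple1 = (aug i a : S).
Proof. exact: mulr1. Qed.

Section Khom.
Variable N : lmodType A.

Definition Khom : Type := homs K (kbimod N).
HB.instance Definition _ := GRing.Zmodule.on Khom.
Implicit Types f g : Khom.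

Definition Khom_app (f : Khom) : {linear K -> N} := f.

Lemma KhomP f g : (forall z, Khom_app f z = Khom_app g z) -> f = g.
Proof. exact: linear_eq. Qed.

Definition Khom_scale (a : A) f : Khom :=
  (Khom_app f \o rmulK a : {linear K -> N}).
Fact Khom_scaleA a b f : Khom_scale a (Khom_scale b f) = Khom_scale (a * b) f.
Proof. by apply: KhomP => z; rewrite /= rmulKA. Qed.
Fact Khom_scale1 : left_id 1 Khom_scale.
Proof.
move=> f; apply: KhomP => z /=; congr (Khom_app f _).
by apply: val_inj; rewrite /= mulr1.
Qed.
Fact Khom_scaleDr : right_distributive Khom_scale +%R.
Proof. by move=> a f g; apply: KhomP. Qed.
Fact Khom_scaleDl f : {morph Khom_scale^~ f : a b / a + b}.
Proof.
move=> a b; apply: KhomP => z /=; rewrite -[RHS](linearD (Khom_app f)).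
by congr (Khom_app f _); apply: val_inj; rewrite /= mulrDr.
Qed.
HB.instance Definition _ := GRing.Zmodule_isLmodule.Build A Khom
  Khom_scaleA Khom_scale1 Khom_scaleDr Khom_scaleDl.

Lemma Khom_appZ a f z : Khom_app (a *: f) z = Khom_app f (rmulK a z).
Proof. by []. Qed.
Lemma Khom_appD f g z : Khom_app (f + g) z = Khom_app f z + Khom_app g z.
Proof. by []. Qed.

Fact Khom_unit_subproof (n : N) : linear (fun z : K => (val z : A) *: n).
Proof. by move=> c x y; rewrite linearP scalerDl scalerA. Qed.
(** Restriction to [K] of the map [A -> N] that sends 1 to [n]. *)
Definition Khom_unit (n : N) : Khom := mk_linear (Khom_unit_subproof n).
Lemma Khom_unitE n z : Khom_app (Khom_unit n) z = (val z : A) *: n.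
Proof. by []. Qed.
Fact Khom_unit_linear : linear Khom_unit.
Proof.
move=> c m n; apply: KhomP => z; rewrite Khom_appD Khom_appZ !Khom_unitE.
by rewrite scalerDr scalerA.
Qed.
HB.instance Definition _ := GRing.isLinear.Build A N Khom *:%R Khom_unit
  Khom_unit_linear.

(** Hence [K] annihilates the cokernel of the unit. *)
Lemma Khom_unit_app f z : (val z : A) *: f = Khom_unit (Khom_app f z).
Proof.
apply: KhomP => y; rewrite Khom_appZ Khom_unitE -linearZ; congr (Khom_app f _).
exact: val_inj.
Qed.
End Khom.

Section KhomMap.
Variables (M N : lmodType A) (v : {linear M -> N}).
Definition Khom_map (f : Khom M) : Khom N := (v \o Khom_app f : {linear K -> N}).
Fact Khom_map_linear : linear Khom_map.
Proof. by move=> c f g; apply: KhomP => z /=; rewrite linearD. Qed.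
HB.instance Definition _ := GRing.isLinear.Build A (Khom M) (Khom N) *:%R
  Khom_map Khom_map_linear.
Lemma Khom_mapE f z : Khom_app (Khom_map f) z = v (Khom_app f z).
Proof. by []. Qed.
Lemma Khom_map_unit m : Khom_map (Khom_unit m) = Khom_unit (v m).
Proof. by apply: KhomP => z; rewrite Khom_mapE !Khom_unitE linearZ. Qed.
End KhomMap.

Lemma augK_scale (N : lmodType A) (n : N) (a : A) :
  (forall z : K, (val z : A) *: n = 0) -> a *: n = kact (aug i a) n.
Proof.
move=> Kn; have z0 : aug i (a - pa_const Q (aug i a)) = 0.
  by rewrite augD augN /pa_const augZ aug1 mulr1 subrr.
have := Kn (mkK z0); rewrite /= scalerBl => /eqP; rewrite subr_eq0.
by move/eqP.
Qed.

(** Applying [Hom(-, N)] to [0 -> K -> A -> S -> 0] gives [0 -> Hom(S, N) -> N -> Hom(K, N) ->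
    Ext(S, N) -> 0]; this is its left end, and [Ext_simple_eq0] is its right end. *)
Lemma Hom_simple_eq0 (N : lmodType A) :
  (forall f : HomQ S N, f = 0) <-> injective (@Khom_unit N).
Proof.
split=> [S0|inj f].
  apply: raddf_inj => n n0.
  have Kn (z : K) : (val z : A) *: n = 0 by rewrite -Khom_unitE n0.
  have lf : linear (fun c : S => kact (c : k) n).
    move=> a c d; rewrite kactDl; congr (_ + _).
    have -> : a *: kact (c : k) n = kact (c : k) (a *: n) by rewrite linearZ.
    by rewrite (augK_scale a Kn) kactA [(c : k) * _]mulrC.
  have := congr1 (fun f : HomQ S N => (f : {linear S -> N}) simple1)
    (S0 (mk_linear lf)).
  by rewrite /= kact1.
pose n := (f : {linear S -> N}) simple1.
have n0 : n = 0.
  apply: inj; apply: KhomP => z; rewrite !Khom_unitE -linearZ.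
  by rewrite simple1Z aug_augK linear0 scaler0.
apply: linear_eq => c.
have -> : c = pa_const Q (c : k) *: simple1.
  by rewrite simple1Z /pa_const augZ aug1 mulr1.
by rewrite linearZ /= -/n n0 scaler0.
Qed.

Lemma aug_map_surj (y : S) : exists x, aug_map x = y.
Proof. by exists (pa_const Q y); rewrite /= /pa_const augZ aug1 mulr1. Qed.

Fact simple_cover x :
  cover_map S (reg_lift (fbasis A simple1) x) = aug_map x.
Proof.
by rewrite linearZ /= /cover_map lin_ext_basis; apply: simple1Z.
Qed.

Lemma Ext_simple_eq0 (N : lmodType A) :
  (forall e : ExtQ S N, e = 0) <-> forall f, exists n, @Khom_unit N n = f.
Proof.
have [t pt] := cover_lift aug_map_surj.
rewrite (ext_eq0P _ simple_cover pt); split=> ex f.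
  have [h fh] := ex (Khom_app f); exists (h 1); apply: KhomP => z.
  by rewrite fh Khom_unitE; apply/esym/regular_linearE.
have [n <-] := ex f; exists (reg_lift n) => z; exact: Khom_unitE.
Qed.

(** Lifting generators of [Ext(S, N)] along [Hom(K, N) -> Ext(S, N)] leaves an ambiguity in the
    image of [N]. This controls the size of [Hom(K, N)]. *)
Lemma ExtQ_fin_dim_Khom (N : lmodType A) : fin_dim (ExtQ S N) ->
  exists n (g : 'I_n -> Khom N), forall f : Khom N,
    exists (c : 'I_n -> k) (m : N),
      f = \sum_l pa_const Q (c l) *: g l + Khom_unit m.
Proof.
have [t pt] := cover_lift aug_map_surj.
move=> [n [e eP]]; 
pose cl : {linear homs K (kbimod N) -> ExtQ S N} :=
  @ext_class _ _ _ _ (kbimod N) _ _ pt.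
have /choice[g gE] l : exists f, cl f = e l.
  exact: (ext_class_surj simple_cover pt).
exists n, g => f; have [c cE] := eP (cl f); exists c.
have : cl (f - \sum_l c l *: g l) = 0.
  rewrite linearB linear_sum cE; apply/eqP; rewrite subr_eq0; apply/eqP.
  by apply: eq_bigr => l _; rewrite linearZ gE.
(* On the left, scalars act through the target [N]; on the right, through right multiplication on
   [K]. The two actions agree because constants are central. *)
have -> : \sum_l c l *: g l =
    (\sum_l pa_const Q (c l) *: (g l : Khom N) : Khom N).
  apply: eq_bigr => l _; apply: KhomP => z; rewrite Khom_appZ.
  rewrite -[LHS]/(pa_const Q (c l) *: Khom_app (g l) z) -linearZ.
  by congr (Khom_app _ _); apply: val_inj; apply: pa_constC.
move=> /(ext_class_eq0 simple_cover)[h hE]; exists (h 1).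
apply/eqP; rewrite addrC -subr_eq; apply/eqP/KhomP => z.
by rewrite Khom_unitE; apply: etrans (hE z) (regular_linearE h (val z)).
Qed.

End Vertex.

(** * Absence of loops and idempotence of [K] *)

Section NoLoop.
Variables (k : fieldType) (Q : quiver) (i : Q).
Local Notation A := (path_alg k Q).
Local Notation S := (simple_module k i).
Local Notation K := (ker (aug_map k i)).
Local Notation idem := (idem k).
Local Notation arrow := (arrow k).
Local Notation Khom := (Khom i).
Local Notation Khom_unit := (Khom_unit i).

Definition no_loop : Prop := forall a : arr Q, src a = i -> tgt a != i.

(** A loop [a] at [i] gives the map [K -> S] that reads the coefficient of [a]. It is left linear on
    [K], takes the value 1 at [a], and cannot extend to [A], since every map [A -> S] kills [a]. *)
Lemma Ext_simple_no_loop : (forall e : ExtQ S S, e = 0) -> no_loop.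
Proof.
move=> /Ext_simple_eq0 ex a ai; apply/eqP => ta.
pose f (z : K) : S := aug i (lfox a (val z : A)).
have fl : linear f.
  move=> c x y; rewrite /f /= linearD augD; congr (_ + _).
  apply: etrans (congr1 (aug i) (lfoxM a c (val x))) _.
  by rewrite ai aug_augK scale0r addr0; apply: augM.
have [n /(congr1 (Khom_app (N := S)))/(congr1 (fun f : {linear K -> S} =>
    f (mkK (aug_arrow k i a))))] := ex (mk_linear fl).
rewrite /= /f /= lfox_arrow eqxx scale1r aug_idem ta eqxx.
rewrite -[_ *: n]/(aug i (arrow a) * n) aug_arrow mul0r => /esym/eqP.
by rewrite oner_eq0.
Qed.

Hypothesis i_no_loop : no_loop.

(** This is the left decomposition of [K] into the [A e_j] with [j != i] and the [A a] with [a] out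
    of [i]: only [x e_i] needs expanding along arrows. The other indices are padded with 0, so that
    both sums run over a full finite type. *)
Lemma aug0_lfox_split (x : A) : aug i x = 0 ->
  x = \sum_j x * idem j * (if j == i then 0 else idem j)
    + \sum_a (src a == i)%:R *: lfox a x * (if src a == i then arrow a else 0).
Proof.
move=> x0.
have e1 : x * idem i = \sum_a (src a == i)%:R *: lfox a x *
    (if src a == i then arrow a else 0).
  rewrite {1}(lfox_sum x) mulrDl !mulr_suml (bigD1 i) //=.
  rewrite x0 scale0r mul0r add0r.
  rewrite big1 ?add0r => [|j /negPf ji]; last first.
    by rewrite -pa_scalerAl idemM ji scale0r scaler0.
  apply: eq_bigr => a _; rewrite -mulrA arrow_idem.
  case: eqP => _; first by rewrite !scale1r.
  by rewrite !scale0r [LHS]mulr0 [RHS]mulr0.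
have e2 : \sum_j x * idem j * (if j == i then 0 else idem j) =
    \sum_(j | j != i) x * idem j.
  rewrite [RHS]big_mkcond; apply: eq_bigr => j _.
  by case: eqP => _; [apply: mulr0 | rewrite -mulrA idem_idem].
rewrite -e1 e2 -[LHS]mulr1 -sum_idem mulr_sumr (bigD1 i) //=.
by rewrite [LHS]addrC.
Qed.

(** This is a dual basis of [K] whose coordinates again take values in [K]. Absence of loops is what
    puts [lfox a z], an element of [A e_(tgt a)], into [K]. *)
Lemma augK_split : exists (I : finType) (u : I -> {linear K -> K}) (v : I -> K),
  forall z : K, z = \sum_l rmulK (val (v l)) (u l z).
Proof.
pose ul a (x : A) : A := (src a == i)%:R *: lfox a x.
have ul0 a (z : K) : aug i (ul a (val z)) = 0.
  rewrite /ul augZ; case: eqP => [/i_no_loop|]; rewrite ?mul0r // mul1r.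
  by rewrite -lfox_tgt augM aug_idem => /negPf->; rewrite mulr0.
have ull a : linear (fun z : K => mkK (ul0 a z)).
  move=> c x y; apply: val_inj; rewrite /= /ul.
  case: eqP => [ai|_]; last by rewrite !scale0r [c *: _]mulr0 addr0.
  rewrite !scale1r linearD; congr (_ + _).
  apply: etrans (lfoxM a c (val x)) _.
  by rewrite ai aug_augK scale0r addr0.
have vj0 j : aug i (if j == i then 0 else idem j) = 0.
  by case: eqP => ji; rewrite ?aug0 // aug_idem; case: eqP.
have va0 a : aug i (if src a == i then arrow a else 0) = 0.
  by case: eqP => ji; rewrite ?aug0 // aug_arrow.
exists (Q + arr Q)%type.
exists (fun l => match l return {linear K -> K} with
  | inl j => rmulK (idem j) | inr a => mk_linear (ull a) end).
exists (fun l => match l with inl j => mkK (vj0 j) | inr a => mkK (va0 a) end).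
move=> z; apply: val_inj; rewrite linear_sum /= big_sumType /=.
exact: (aug0_lfox_split (aug_augK z)).
Qed.

Lemma rmulK_val (x y : K) : rmulK (val y) x = (val x : A) *: y.
Proof. exact: val_inj. Qed.

Lemma augK_prod_eq (X : lmodType A) (f g : {linear K -> X}) :
  (forall x y : K, f (rmulK (val y) x) = g (rmulK (val y) x)) -> f =1 g.
Proof.
have [I [u [v uv]]] := augK_split.
by move=> fg z; rewrite [z]uv !linear_sum; apply: eq_bigr => l _; apply: fg.
Qed.

(* The multiplication [K (x)_A K -> K] is bijective. *)
Lemma augK_balanced (X : lmodType A) (B : K -> K -> X) :
    (forall y, linear (B^~ y)) -> (forall x, {morph B x : y z / y + z}) ->
    (forall x a y, B (rmulK a x) y = B x (a *: y)) ->
  exists f : {linear K -> X}, forall x y, f (rmulK (val y) x) = B x y.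
Proof.
move=> Bl Br Bbal; have [I [u [v uv]]] := augK_split.
have B0 x : B x 0 = 0 by apply: (addrI (B x 0)); rewrite -Br !addr0.
have fl : linear (fun z => \sum_l B (u l z) (v l)).
  move=> c x y; rewrite scaler_sumr -big_split /=; apply: eq_bigr => l _.
  by rewrite linearP Bl.
exists (mk_linear fl) => x y /=.
(* Expanding [y] as the sum of the [u l y * v l], balancedness moves [u l y] to the left argument,
   where [x * u l y = u l (x * y)] by linearity. *)
rewrite {2}[y]uv (big_morph (B x) (Br x) (B0 x)); apply: eq_bigr => l _.
rewrite (rmulK_val x y) (rmulK_val (u l y) (v l)) linearZ /= -Bbal.
by rewrite rmulK_val.
Qed.

Lemma Khom_unit_Khom_inj (N : lmodType A) : injective (Khom_unit (N := Khom N)).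
Proof.
apply: raddf_inj => f f0; apply: KhomP; apply: augK_prod_eq => x y.
by rewrite -Khom_appZ -Khom_unitE f0.
Qed.

(** A map [K -> Hom(K, N)] is a balanced pairing on [K], so it factors through the multiplication of
    [K]; the factor is the preimage. *)
Lemma Khom_unit_Khom_surj (N : lmodType A) (f : Khom (Khom N)) :
  exists g, Khom_unit g = f.
Proof.
have [|||g gE] := @augK_balanced N (fun x y => Khom_app (Khom_app f y) x).
- by move=> y c u v; rewrite linearP.
- by move=> x y z; rewrite linearD.
- by move=> x a y; rewrite linearZ.
exists (g : Khom N); apply: KhomP => y; apply: KhomP => x.
by rewrite Khom_unitE Khom_appZ -gE.
Qed.

End NoLoop.

(** * The functor K (x) - *)

Section IncomingFox.
Variables (k : fieldType) (Q : quiver) (i : Q).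
Local Notation A := (path_alg k Q).
Local Notation idem := (idem k).
Local Notation arrow := (arrow k).
Implicit Types (a b : arr Q) (x y : A).

(** This scalar cuts off families indexed by all arrows, so that their entries vanish at the arrows
    not ending at [i]. *)
Definition into b : k := (tgt b == i)%:R.
Definition ifox b x : A := into b *: rfox b x.
Definition iarr b : A := into b *: arrow b.
Definition isrc b : A := into b *: idem (src b).

Lemma intoM b : into b * into b = into b.
Proof. by rewrite /into -natrM mulnb andbb. Qed.

Fact ifox_linear b : linear (ifox b).
Proof. by move=> c x y; rewrite /ifox linearP scalerDr !scalerA mulrC. Qed.
HB.instance Definition _ b := GRing.isLinear.Build k A A *:%R (ifox b)
  (ifox_linear b).

Lemma ifoxM b x y : ifox b (x * y) = ifox b x * y + aug i x *: ifox b y.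
Proof.
rewrite /ifox rfoxM scalerDr pa_scalerAl !scalerA /into.
by case: eqP => [->|]; rewrite ?mul1r ?mulr1 // mul0r mulr0.
Qed.

Lemma iarr_eq0 b : tgt b != i -> iarr b = 0.
Proof. by rewrite /iarr /into => /negPf->; rewrite scale0r. Qed.
Lemma isrc_eq0 b : tgt b != i -> isrc b = 0.
Proof. by rewrite /isrc /into => /negPf->; rewrite scale0r. Qed.
Lemma iarrE b : tgt b = i -> iarr b = arrow b.
Proof. by rewrite /iarr /into => ->; rewrite eqxx scale1r. Qed.
Lemma isrc_idem b : isrc b * isrc b = isrc b.
Proof.
by rewrite /isrc -pa_scalerAl -pa_scalerAr scalerA intoM idem_idem.
Qed.

Lemma isrc_ifox b x : isrc b * ifox b x = ifox b x.
Proof.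
by rewrite /isrc -pa_scalerAl -pa_scalerAr scalerA intoM idem_rfox.
Qed.

Lemma iarr_src b : iarr b * isrc b = iarr b.
Proof.
by rewrite /iarr -pa_scalerAl -pa_scalerAr scalerA intoM arrow_idem eqxx scale1r.
Qed.

Lemma idem_iarr b : idem i * iarr b = iarr b.
Proof. by rewrite -pa_scalerAr idem_arrow scalerA intoM. Qed.

Lemma ifox_iarr a b : ifox a (iarr b) = (b == a)%:R *: isrc b.
Proof.
rewrite /ifox linearZ /= rfox_arrow !scalerA mulrC.
by case: eqP => [->|]; rewrite ?mulr1 ?mul0r ?mul1r ?scale0r // intoM.
Qed.

Lemma ifox_idem b j : ifox b (idem j) = 0.
Proof. by rewrite /ifox rfox_idem scaler0. Qed.

Lemma ifox1 b : ifox b 1 = 0.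
Proof. by rewrite /ifox rfox1 scaler0. Qed.

Lemma aug_iarr j b : aug j (iarr b) = 0.
Proof. by rewrite augZ aug_arrow mulr0. Qed.

Lemma aug_isrc b : no_loop i -> aug i (isrc b) = 0.
Proof.
rewrite augZ aug_idem /into -natrM mulnb => nl.
by case: (eqVneq (src b) i) => [/nl/negPf->|]; rewrite ?andbF.
Qed.

(** The component at [i] of [rfox_sum]: [e_i A] is [k e_i] plus the right ideals [b A] for the
    arrows [b] into [i]. *)
Lemma ifox_sum x :
  idem i * x = aug i x *: idem i + \sum_b iarr b * ifox b x.
Proof.
rewrite {1}(rfox_sum x) mulrDr; apply: (f_equal2 +%R).
  rewrite mulr_sumr (bigD1 i) //= big1 => [|j /negPf ji]; last first.
    by rewrite -pa_scalerAr idemM eq_sym ji scale0r scaler0.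
  by rewrite -pa_scalerAr idem_idem addr0.
rewrite mulr_sumr; apply: eq_bigr => b _.
rewrite mulrA idem_arrow -[LHS]pa_scalerAl /iarr /ifox -[RHS]pa_scalerAl.
by rewrite -pa_scalerAr scalerA -/(into b) intoM.
Qed.

Lemma kact_scale (N : lmodType A) (c : k) x (n : N) :
  (c *: x) *: n = kact c (x *: n).
Proof. by rewrite /kact scalerA -pa_scalerAl mul1r. Qed.

Lemma kactZ (N : lmodType A) (c : k) x (n : N) :
  kact c (x *: n) = x *: kact c n.
Proof. exact: linearZ. Qed.

End IncomingFox.
Opaque into ifox iarr isrc.

Section Ktens.
Variables (k : fieldType) (Q : quiver) (i : Q).
Local Notation A := (path_alg k Q).
Local Notation K := (ker (aug_map k i)).
Local Notation idem := (idem k).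
Local Notation ifox := (ifox i).
Local Notation iarr := (iarr k i).
Local Notation isrc := (isrc k i).

Section Object.
Variable N : lmodType A.

(* [Ktens] is [K (x)_A N]. As a right module, [K] is the sum of [e_j A] for
   [j != i] and of [b A = e_(src b) A] for the arrows [b] into [i]; so an
   element of [K (x) N] is a family [(n_j)_(j != i), (nu_b)_b], stored as the
   pair of its image [m] in [N] (of which [n_j] is the component at [j]) and of
   [nu]. The scaling is dictated by
   [a b = sum_c c (rfox c a) b + aug i a b]. *)
Definition Kpre : Type := (N * {ffun arr Q -> N})%type.
HB.instance Definition _ := GRing.Zmodule.on Kpre.

Definition Kpre_scale (a : A) (x : Kpre) : Kpre :=
  (a *: x.1, [ffun b => ifox b a *: x.1 + kact (aug i a) (x.2 b)]).
Fact Kpre_scaleA a b x : Kpre_scale a (Kpre_scale b x) = Kpre_scale (a * b) x.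
Proof.
congr (_, _); rewrite /= ?scalerA //; apply/ffunP => c; rewrite !ffunE /=.
rewrite ifoxM augM scalerDl kact_scale -kactA linearD /= -addrA scalerA.
by [].
Qed.
Fact Kpre_scale1 : left_id 1 Kpre_scale.
Proof.
move=> [m nu]; congr (_, _); rewrite /= ?scale1r //; apply/ffunP => c.
by rewrite !ffunE /= ifox1 scale0r add0r aug1 kact1.
Qed.
Fact Kpre_scaleDr : right_distributive Kpre_scale +%R.
Proof.
move=> a x y; congr (_, _); rewrite /= ?scalerDr //; apply/ffunP => c.
by rewrite !ffunE /= scalerDr linearD addrACA.
Qed.
Fact Kpre_scaleDl x : {morph Kpre_scale^~ x : a b / a + b}.
Proof.
move=> a b; congr (_, _); rewrite /= ?scalerDl //; apply/ffunP => c.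
by rewrite !ffunE /= linearD scalerDl augD kactDl addrACA.
Qed.
HB.instance Definition _ := GRing.Zmodule_isLmodule.Build A Kpre
  Kpre_scaleA Kpre_scale1 Kpre_scaleDr Kpre_scaleDl.

Lemma Kpre_scale2E a (x : Kpre) b :
  (a *: x).2 b = ifox b a *: x.1 + kact (aug i a) (x.2 b).
Proof. by rewrite ffunE. Qed.

(** The component at [i] of the image in [N] is redundant, being determined by the family [nu]. The
    second condition places [nu b] in [e_(src b) N], and makes it 0 if [b] does not end at [i]. *)
Definition Ktens_pred : pred Kpre := fun x : Kpre =>
  (idem i *: x.1 == \sum_b iarr b *: x.2 b) &&
  [forall b, isrc b *: x.2 b == x.2 b].

Lemma Ktens_predP (x : Kpre) : reflect
  (idem i *: x.1 = \sum_b iarr b *: x.2 b /\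
    forall b, isrc b *: x.2 b = x.2 b) (Ktens_pred x).
Proof.
apply: (iffP andP) => [[/eqP e1 /forallP e2]|[e1 e2]]; split.
- by [].
- by move=> b; apply/eqP.
- exact/eqP.
- by apply/forallP => b; apply/eqP.
Qed.

Fact Ktens_pred_closed : subsemimod_closed Ktens_pred.
Proof.
split; first split.
- apply/Ktens_predP; split=> [|b] /=; last by rewrite ffunE scaler0.
  by rewrite scaler0 big1 // => b _; rewrite ffunE scaler0.
- move=> x y /Ktens_predP[x1 x2] /Ktens_predP[y1 y2]; apply/Ktens_predP.
  split=> [|b] /=; last by rewrite ffunE scalerDr x2 y2.
  rewrite scalerDr x1 y1 -big_split; apply: eq_bigr => b _ /=.
  by rewrite ffunE scalerDr.
move=> a x /Ktens_predP[x1 x2]; apply/Ktens_predP.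
split=> [|b]; last first.
  by rewrite Kpre_scale2E scalerDr scalerA isrc_ifox -kactZ x2.
have -> : idem i *: (a *: x).1 =
    kact (aug i a) (idem i *: x.1) + \sum_b (iarr b * ifox b a) *: x.1.
  by rewrite -kact_scale -scaler_suml -scalerDl -ifox_sum -scalerA.
rewrite x1 linear_sum /= addrC -big_split /=; apply: eq_bigr => b _.
by rewrite Kpre_scale2E scalerDr kactZ -scalerA.
Qed.
Definition Ktens : Type := {x | Ktens_pred x}.
HB.instance Definition _ := SubChoice.on Ktens.
HB.instance Definition _ := GRing.SubChoice_isSubLmodule.Build A Kpre Ktens_pred
  Ktens Ktens_pred_closed.

Lemma KtensP (x y : Ktens) :
  (val x).1 = (val y).1 -> (forall b, (val x).2 b = (val y).2 b) -> x = y.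
Proof.
move=> e1 e2; apply: val_inj; rewrite [LHS]surjective_pairing e1.
by rewrite [RHS]surjective_pairing; congr (_, _); apply/ffunP.
Qed.

Lemma Ktens_idem (x : Ktens) : idem i *: (val x).1 = \sum_b iarr b *: (val x).2 b.
Proof. by case/Ktens_predP: (valP x). Qed.
Lemma Ktens_src (x : Ktens) b : isrc b *: (val x).2 b = (val x).2 b.
Proof. by case/Ktens_predP: (valP x). Qed.

Definition Ktens_counit (x : Ktens) : N := (val x).1.
Fact Ktens_counit_linear : linear Ktens_counit.
Proof. by []. Qed.
HB.instance Definition _ := GRing.isLinear.Build A Ktens N *:%R Ktens_counit
  Ktens_counit_linear.

Definition tens_val (z : K) (n : N) : Kpre :=
  ((val z : A) *: n, [ffun b => ifox b (val z : A) *: n]).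
Fact tens_subproof z n : Ktens_pred (tens_val z n).
Proof.
apply/Ktens_predP; split=> [|b] /=; last by rewrite ffunE scalerA isrc_ifox.
rewrite scalerA ifox_sum aug_augK scale0r add0r scaler_suml.
by apply: eq_bigr => b _; rewrite ffunE scalerA.
Qed.
Definition tens z n : Ktens := exist _ (tens_val z n) (tens_subproof z n).

Lemma tens_linear n : linear (tens^~ n).
Proof.
move=> a x y; apply: KtensP => [|b] /=; first by rewrite scalerDl scalerA.
have e : ifox b (a * (val x : A) + (val y : A)) =
    ifox b a * (val x : A) + aug i a *: ifox b (val x : A) + ifox b (val y : A).
  by rewrite linearD /= ifoxM.
rewrite !ffunE; apply: etrans (congr1 ( *:%R^~ n) e) _.
by rewrite !scalerDl kact_scale -scalerA.
Qed.

Lemma tensD z : {morph tens z : m n / m + n}.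
Proof.
move=> m n; apply: KtensP => [|b] /=; first by rewrite scalerDr.
by rewrite ffunE [RHS]ffunE !ffunE scalerDr.
Qed.

Lemma tens_balanced z a n : tens (rmulK a z) n = tens z (a *: n).
Proof.
apply: KtensP => [|b] /=; first by rewrite scalerA.
by rewrite !ffunE ifoxM aug_augK scale0r addr0 scalerA.
Qed.

End Object.
End Ktens.

Section FinGen.
Variables (k : fieldType) (Q : quiver).
Local Notation A := (path_alg k Q).
Variables (M : lmodType A) (I : finType) (g : I -> M).

Definition spanned (m : M) : Prop := exists a : I -> A, m = \sum_l a l *: g l.

Lemma spanned_gen l : spanned (g l).
Proof.
exists (fun j => if j == l then 1 else 0); rewrite (bigD1 l) //= eqxx scale1r.
by rewrite big1 ?addr0 // => j /negPf->; rewrite scale0r.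
Qed.

Lemma spannedZ a m : spanned m -> spanned (a *: m).
Proof.
move=> [c ->]; exists (fun l => a * c l); rewrite scaler_sumr.
by apply: eq_bigr => l _; rewrite scalerA.
Qed.

Lemma spannedD m n : spanned m -> spanned n -> spanned (m + n).
Proof.
move=> [c ->] [d ->]; exists (fun l => c l + d l); rewrite -big_split.
by apply: eq_bigr => l _; rewrite scalerDl.
Qed.

Lemma spanned_sum (J : finType) (m : J -> M) :
  (forall j, spanned (m j)) -> spanned (\sum_j m j).
Proof.
move=> sm; apply: (big_ind spanned) => //; last exact: spannedD.
by exists (fun=> 0); rewrite big1 // => l _; rewrite scale0r.
Qed.

Lemma spanned_fin_gen : (forall m, spanned m) -> fin_gen M.
Proof.
move=> sg; exists #|I|, (g \o enum_val) => m; have [a ->] := sg m.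
by exists (a \o enum_val); rewrite (reindex (@enum_val I I)) //=;
  apply/onW_bij/enum_val_bij.
Qed.
End FinGen.

(** * Comparison of [K (x) -] with [Hom(K, -)], and finite generation *)

Section KtensTheory.
Variables (k : fieldType) (Q : quiver) (i : Q).
Local Notation A := (path_alg k Q).
Local Notation S := (simple_module k i).
Local Notation K := (ker (aug_map k i)).
Local Notation idem := (idem k).
Local Notation ifox := (ifox i).
Local Notation iarr := (iarr k i).
Local Notation isrc := (isrc k i).
Local Notation Khom := (Khom i).
Local Notation Ktens := (Ktens i).

Section Sums.
Variables (N : lmodType A) (J : finType) (x : J -> Ktens N).
Lemma Ktens_sum1 : (val (\sum_j x j)).1 = \sum_j (val (x j)).1.
Proof. exact: (linear_sum (@Ktens_counit _ _ i N)). Qed.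
Lemma Ktens_sum2 b : (val (\sum_j x j)).2 b = \sum_j (val (x j)).2 b.
Proof.
by apply: (big_morph (fun y : Ktens N => (val y).2 b)) => [u v|];
  rewrite /= ffunE.
Qed.
End Sums.

Lemma Ktens_gen (N : lmodType A) (x : Ktens N) :
  exists (I : finType) (z : I -> K) (n : I -> N), x = \sum_l tens (z l) (n l).
Proof.
have vj0 j : aug i (if j == i then 0 else idem j) = 0.
  by case: eqP => ji; rewrite ?aug0 // aug_idem; case: eqP.
exists (Q + arr Q)%type.
exists (fun l => match l with
  inl j => mkK (vj0 j) | inr b => mkK (aug_iarr k i i b) end).
exists (fun l => match l with inl j => (val x).1 | inr b => (val x).2 b end).
apply: KtensP => [|c]; rewrite ?Ktens_sum1 ?Ktens_sum2 big_sumType /=.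
  rewrite -Ktens_idem -{1}[(val x).1]scale1r -sum_idem scaler_suml.
  rewrite (bigD1 i) //= addrC; congr (_ + _); rewrite big_mkcond.
  by apply: eq_bigr => j _; case: eqP => _; rewrite ?scale0r.
rewrite big1 ?add0r => [|j _]; last first.
  rewrite ffunE; case: eqP => _; last by rewrite ifox_idem scale0r.
  by rewrite linear0 scale0r.
rewrite (bigD1 c) //= big1 ?addr0 => [|b /negPf bc].
  by rewrite ffunE ifox_iarr eqxx scale1r Ktens_src.
by rewrite ffunE ifox_iarr bc scale0r scale0r.
Qed.

Section Map.
Variables (M N : lmodType A) (v : {linear M -> N}).

Definition Ktens_map_val (x : Ktens M) : Kpre N :=
  (v (val x).1, [ffun b => v ((val x).2 b)]).
Fact Ktens_map_subproof x : Ktens_pred i (Ktens_map_val x).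
Proof.
apply/Ktens_predP; split=> [|b] /=; last by rewrite ffunE -linearZ Ktens_src.
rewrite -linearZ Ktens_idem linear_sum; apply: eq_bigr => b _.
by rewrite /= ffunE linearZ.
Qed.
Definition Ktens_map (x : Ktens M) : Ktens N :=
  exist _ (Ktens_map_val x) (Ktens_map_subproof x).
Fact Ktens_map_linear : linear Ktens_map.
Proof.
move=> a x y; apply: KtensP => [|b] /=; first by rewrite linearP.
rewrite !ffunE /= linearD; congr (_ + _).
by rewrite linearD /kact /= !linearZ.
Qed.
HB.instance Definition _ := GRing.isLinear.Build A (Ktens M) (Ktens N) *:%R
  Ktens_map Ktens_map_linear.

Lemma Ktens_map_tens z m : Ktens_map (tens z m) = tens z (v m).
Proof.
by apply: KtensP => [|b] /=; rewrite ?ffunE linearZ.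
Qed.

End Map.

(** In a tensor product over [A], [z * x] is [z (x) n] for [n] the image of [x] in [N]. *)
Lemma counit_ker (N : lmodType A) (x : Ktens N) (z : K) :
  Ktens_counit x = 0 -> (val z : A) *: x = 0.
Proof.
move=> x0; apply: KtensP => [|b] /=.
  by rewrite -[sval x]/(val x) -/(Ktens_counit x) x0 scaler0.
by rewrite !ffunE -[sval x]/(val x) -/(Ktens_counit x) x0 scaler0 aug_augK add0r
  /kact /pa_const scale0r scale0r.
Qed.

Hypothesis i_no_loop : no_loop i.

Lemma tens_sum_split : exists (I : finType) (u : I -> K -> K) (v : I -> K),
  forall (N : lmodType A) (z : K) (n : N),
  tens z n = \sum_l (val (u l z) : A) *: tens (v l) n /\
  tens z n = \sum_l tens (u l z) ((val (v l) : A) *: n).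
Proof.
have [I [u [v uv]]] := augK_split k i_no_loop.
exists I, (fun l => u l), v => N z n.
have tl := @tens_linear k Q i N n.
pose t := mk_linear tl.
have e : tens z n = \sum_l tens (rmulK (val (v l)) (u l z)) n.
  by rewrite -[tens z n]/(t z) {1}[z]uv linear_sum.
split; rewrite e; apply: eq_bigr => l _; last exact: tens_balanced.
by rewrite rmulK_val -[LHS]/(t _) linearZ.
Qed.

(** A map from [K] into the kernel of the counit vanishes on products [x * y], since [x] annihilates
    that kernel; and products generate [K]. *)
Lemma Khom_map_counit_inj (N : lmodType A) :
  injective (Khom_map (i := i) (@Ktens_counit _ _ i N)).
Proof.
apply: raddf_inj => f f0; apply: KhomP; apply: augK_prod_eq => // x y.
have fy : Ktens_counit (Khom_app f y) = 0 by rewrite -Khom_mapE f0.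
by rewrite rmulK_val linearZ [RHS]linearZ /= counit_ker // scaler0.
Qed.

Lemma Khom_map_counit_surj (N : lmodType A) (g : Khom N) :
  exists f, Khom_map (i := i) (@Ktens_counit _ _ i N) f = g.
Proof.
have [|||f fE] :=
    @augK_balanced k Q i i_no_loop (Ktens N) (fun x y => tens x (Khom_app g y)).
- by move=> y; apply: (@tens_linear k Q i N).
- by move=> x y z; rewrite linearD tensD.
- by move=> x a y; rewrite tens_balanced linearZ.
exists (f : Khom (Ktens N)); apply: KhomP; apply: (augK_prod_eq i_no_loop) => x y.
transitivity (Ktens_counit (tens x (Khom_app g y))).
  exact/(congr1 (@Ktens_counit _ _ i N))/fE.
by rewrite rmulK_val linearZ.
Qed.

(** The kernel of the unit is annihilated by [K], whereas an element of [K (x) N] is determined by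
    components fixed by idempotents that lie in [K]: the [e_j] with [j != i] and, as there is no
    loop, the [isrc b]. *)
Lemma Ktens_map_unit_inj (N : lmodType A) :
  injective (Ktens_map (@Khom_unit _ _ i N)).
Proof.
apply: raddf_inj => x x0.
have Kn n (z : K) : Khom_unit i n = 0 -> (val z : A) *: n = 0 :> N.
  by rewrite -Khom_unitE => ->.
have nu0 b : (val x).2 b = 0.
  rewrite -Ktens_src; apply: (Kn _ (mkK (aug_isrc k b i_no_loop))).
  by have := congr1 (fun y : Ktens _ => (val y).2 b) x0; rewrite /= !ffunE.
apply: KtensP => // [|b]; last by rewrite nu0 /= ffunE.
have m0 : Khom_unit i (val x).1 = 0.
  by have := congr1 (fun y : Ktens _ => (val y).1) x0.
rewrite -[LHS]scale1r -sum_idem scaler_suml big1 // => j _.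
have [->|/negPf ji] := eqVneq j i.
  by rewrite Ktens_idem big1 // => b _; rewrite nu0 scaler0.
have j0 : aug i (idem j) = 0 by rewrite aug_idem ji.
exact: (Kn _ (mkK j0)).
Qed.

Lemma Ktens_map_unit_surj (N : lmodType A) (y : Ktens (Khom N)) :
  exists x, Ktens_map (@Khom_unit _ _ i N) x = y.
Proof.
have [J [z [f ->]]] := Ktens_gen y; have [I [u [v uv]]] := tens_sum_split.
exists (\sum_j \sum_l tens (u l (z j)) (Khom_app (f j) (v l))).
rewrite linear_sum; apply: eq_bigr => j _; rewrite linear_sum.
rewrite (uv _ (z j) (f j)).2; apply: eq_bigr => l _.
by rewrite [LHS]Ktens_map_tens Khom_unit_app.
Qed.

(** Comparing components at [b] in the relation [Ktens_idem] shows that [nu b] has image 0 in [N].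
    So [K] annihilates [nu b], which is nevertheless fixed by [isrc b], an element of [K]. *)
Lemma counit_Ktens_inj (N : lmodType A) :
  injective (@Ktens_counit _ _ i (Ktens N)).
Proof.
apply: raddf_inj => y y0.
suff nu0 b : (val y).2 b = 0 by apply: KtensP => // b; rewrite nu0 /= ffunE.
have srcE := Ktens_src y b; set w := (val y).2 b in srcE *.
have w0 : (val w).1 = 0.
  have := congr1 (fun x : Ktens _ => (val x).2 b) (Ktens_idem y).
  rewrite -[(val y).1]/(Ktens_counit y) y0 scaler0 Ktens_sum2 (bigD1 b) //=.
  rewrite big1 ?addr0 => [|c /negPf cb].
    rewrite !ffunE ifox_iarr eqxx scale1r aug_iarr /kact /pa_const !scale0r addr0.
    by move=> w0; rewrite -srcE.
  by rewrite ffunE ifox_iarr cb aug_iarr /kact /pa_const !scale0r addr0.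
rewrite -srcE; apply: KtensP => [|c] /=.
  by rewrite -[sval w]/(val w) w0 scaler0.
by rewrite !ffunE -[sval w]/(val w) w0 scaler0 aug_isrc // /kact /pa_const
  !scale0r addr0.
Qed.

Lemma counit_Ktens_surj (N : lmodType A) (x : Ktens N) :
  exists y : Ktens (Ktens N), Ktens_counit y = x.
Proof.
have [J [z [n ->]]] := Ktens_gen x; have [I [u [v uv]]] := tens_sum_split.
exists (\sum_j \sum_l tens (u l (z j)) (tens (v l) (n j))).
rewrite linear_sum; apply: eq_bigr => j _; rewrite linear_sum.
by rewrite (uv _ (z j) (n j)).1.
Qed.

Lemma Ktens_fin_gen (N : lmodType A) : fin_gen N -> fin_gen (Ktens N).
Proof.
move=> [s [g gP]]; have [I [u [v uv]]] := tens_sum_split.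
apply: (@spanned_fin_gen _ _ _ (I * 'I_s)%type
  (fun p => tens (v p.1) (g p.2))) => x.
have [J [z [n ->]]] := Ktens_gen x; apply: spanned_sum => j.
have [a ->] := gP (n j).
have -> : tens (z j) (\sum_r a r *: g r) = \sum_r tens (rmulK (a r) (z j)) (g r).
  rewrite (big_morph (tens (z j)) (tensD (z j)) (id1 := 0)) => [|].
    by apply: eq_bigr => r _; rewrite tens_balanced.
  by apply: (addrI (tens (z j) 0)); rewrite -tensD !addr0.
apply: spanned_sum => r; rewrite (uv _ _ (g r)).1; apply: spanned_sum => l.
exact/spannedZ/(spanned_gen (fun p : I * 'I_s => tens (v p.1) (g p.2)) (l, r)).
Qed.

Lemma Khom_fin_gen (N : lmodType A) :
  fin_dim (ExtQ S N) -> fin_gen N -> fin_gen (Khom N).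
Proof.
move=> /ExtQ_fin_dim_Khom[r [f fP]] [s [g gP]].
pose h (l : 'I_r + 'I_s) : Khom N :=
  match l with inl l => f l | inr l => Khom_unit i (g l) end.
apply: (@spanned_fin_gen _ _ _ _ h) => e; have [c [m ->]] := fP e.
apply: spannedD.
  by apply: spanned_sum => l; apply/spannedZ/(spanned_gen h (inl l)).
have [a ->] := gP m; rewrite linear_sum; apply: spanned_sum => l.
by rewrite linearZ; apply/spannedZ/(spanned_gen h (inr l)).
Qed.
End KtensTheory.

(** * The partner of a simple module *)

Section InjectiveSimple.
Variables (k : fieldType) (Q : quiver) (i : Q).
Local Notation A := (path_alg k Q).
Local Notation S := (simple_module k i).
Local Notation idem := (idem k).
Local Notation arrow := (arrow k).

(** Right multiplication by an arrow [b] into [i] embeds [P_i] into [A], with [lfox b] as left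
    inverse. The projection [P_i -> S] does not extend along it, since a map [A -> S] kills [b]. *)
Lemma injective_simple_source :
  injective_module S -> forall b : arr Q, tgt b != i.
Proof.
move=> inj b; apply/eqP => bi.
pose u (x : proj_module k i) : A^o := (val x : A) * arrow b.
have ul : linear u by move=> a x y; rewrite /u /= [LHS]mulrDl -mulrA.
pose f (x : proj_module k i) : S := aug i (val x : A).
have fl : linear f.
  by move=> a x y; rewrite /f /= augD; congr (_ + _); apply: augM.
have uK : injective (mk_linear ul).
  apply: raddf_inj => x /(congr1 (lfox b)); rewrite /= lfoxM lfox_arrow eqxx bi.
  rewrite scale1r aug_arrow scale0r addr0 linear0 => x0.
  by apply: val_inj; rewrite /= -x0; apply/esym/eqP/(valP x).
have [g gE] := inj _ _ (mk_linear ul) (mk_linear fl) uK.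
have e0 : proj_pred i (idem i) by apply/eqP/idem_idem.
have := gE (exist _ (idem i) e0); rewrite /= /f /= aug_idem eqxx.
rewrite /u /= idem_arrow bi eqxx scale1r regular_linearE.
rewrite -[_ *: _]/(aug i (arrow b) * _) aug_arrow mul0r => /esym/eqP.
by rewrite oner_eq0.
Qed.

Hypothesis source : forall b : arr Q, tgt b != i.

Lemma source_idem a : idem i * a = aug i a *: idem i.
Proof.
rewrite (ifox_sum i) big1 ?addr0 // => b _.
by rewrite iarr_eq0 // mul0r.
Qed.

Section Extension.
Variables (M N : lmodType A) (u : {linear M -> N}) (f : {linear M -> S}).
Hypothesis u_inj : injective u.
Variable m0 : M.
Hypotheses (f_m0 : f m0 = simple1 k i) (m0_idem : idem i *: m0 = m0).
Local Notation v := (u m0).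

Definition avoiding (W : N -> Prop) : Prop :=
  [/\ forall m, f m = 0 -> W (u m),
      forall a x y, W x -> W y -> W (a *: x + y) & ~ W v].

(** Zorn's lemma supplies what turns out to be a complement of the line through [v]; the extension
    of [f] will be the projection onto that line. *)
Lemma avoiding_maximal : exists2 W, avoiding W &
  forall n, ~ W n -> exists w a, W w /\ v = w + a *: n.
Proof.
have ker_av : avoiding (fun n => exists2 m, f m = 0 & u m = n).
  split; first by move=> m; exists m.
    move=> a _ _ [x x0 <-] [y y0 <-]; exists (a *: x + y); rewrite linearP //.
    by rewrite x0 y0 scaler0 addr0.
  case=> m fm /u_inj mE; move: fm; rewrite mE f_m0 => /eqP.
  by rewrite oner_eq0.
pose P : classical_sets.set (classical_sets.set N) :=
  fun W => (forall n, ~ W n) \/ avoiding W.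
have [|W [PW maxW]] := @classical_sets.Zorn_bigcup N P.
  move=> F FP Ftot; have [F0|] := pselect (forall X, F X -> forall n, ~ X n).
    by left=> n [X FX Xn]; apply: (F0 X FX n Xn).
  move=> /existsNP[X0 /not_implyP[FX0 /existsNP[n0 /contrapT Xn0]]]; right.
  have av X n : F X -> X n -> avoiding X.
    by move=> /FP[X0' /X0'|].
  split.
  - by move=> m fm; exists X0 => //; have [+ _ _] := av _ _ FX0 Xn0; apply.
  - move=> a x y [X FX Xx] [Y FY Yy].
    have [_ Xl _] := av _ _ FX Xx; have [_ Yl _] := av _ _ FY Yy.
    by case: (Ftot X Y FX FY) => le; [exists Y | exists X] => //;
      [apply: Yl => //; apply: le | apply: Xl => //; apply: le].
  - by move=> [X FX Xv]; have [_ _] := av _ _ FX Xv; apply.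
have {PW} avW : avoiding W.
  case: PW => // W0; case: (maxW (fun n => exists2 m, f m = 0 & u m = n)).
    split; first by move=> n /W0.
    by move=> /(_ 0) W00; apply/(W0 0)/W00; exists 0; rewrite linear0.
  by right.
exists W => // n Wn; have [Wu Wl Wv] := avW.
have W0 : W 0 by rewrite -(linear0 u); apply/Wu/linear0.
apply: contrapT => nv.
case: (maxW (fun x => exists w a, W w /\ x = w + a *: n)).
  split; first by move=> w Ww; exists w, 0; rewrite scale0r addr0.
  by move=> /(_ n) le; apply/Wn/le; exists 0, 1; rewrite scale1r add0r.
right; split=> //.
  by move=> m fm; exists (u m), 0; rewrite scale0r addr0; split=> //; apply: Wu.
move=> a _ _ [x [c [Wx ->]]] [y [d [Wy ->]]].
exists (a *: x + y), (a * c + d); split; first exact: Wl.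
by rewrite scalerDr scalerDl scalerA addrACA.
Qed.

(** At a source, [e_i a] is a scalar multiple of [e_i]. After projection by [e_i], the relation
    [v = w + a n] of maximality becomes one with scalar coefficients, so [N] is [W] plus the line of
    [v], and [g] is the coefficient of [v]. *)
Lemma source_extend : exists g : {linear N -> S}, forall x, g (u x) = f x.
Proof.
have [W [Wu Wl Wv] maxW] := avoiding_maximal.
have W0 : W 0 by rewrite -(linear0 u); apply/Wu/linear0.
have WD x y : W x -> W y -> W (x + y).
  by move=> Wx Wy; rewrite -[x]scale1r; apply: Wl.
have WZ a x : W x -> W (a *: x).
  by move=> Wx; rewrite -[_ *: _]addr0; apply: Wl.
have v_idem : idem i *: v = v by rewrite -linearZ m0_idem.
have idemE n a : idem i *: (a *: n) = kact (aug i a) (idem i *: n).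
  by rewrite scalerA source_idem kact_scale.
have Wc c : W (kact c v) -> c = 0.
  move=> Wcv; apply/eqP/negPn/negP => c0; apply: Wv.
  by rewrite -[v]kact1 -(mulVf c0) -kactA; apply: WZ.
have ex n : exists c : k, W (n - kact c v).
  have [Wn|nWn] := pselect (W n).
    by exists 0; rewrite /kact /pa_const scale0r scale0r subr0.
  have [w [a [Ww vE]]] := maxW n nWn.
  have e1 : v = idem i *: w + kact (aug i a) (idem i *: n).
    by rewrite -{1}v_idem {1}vE scalerDr idemE.
  have a0 : aug i a != 0.
    apply/eqP => a0; apply: Wv; rewrite e1 a0 /kact /pa_const !scale0r addr0.
    exact: WZ.
  have Wn' : W (n - idem i *: n).
    apply: contrapT => /maxW[w' [a' [Ww' vE']]]; apply: Wv.
    rewrite -v_idem vE' scalerDr idemE scalerBr scalerA idem_idem subrr.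
    by rewrite linear0 addr0; apply: WZ.
  exists (aug i a)^-1.
  have -> : n - kact (aug i a)^-1 v =
      (n - idem i *: n) + (- pa_const Q (aug i a)^-1) *: (idem i *: w).
    rewrite e1 linearD /= kactA mulVf // kact1 scaleNr opprD addrCA addrC.
    by rewrite -addrA [- _ - _]addrC.
  by apply: WD => //; apply/WZ/WZ.
have [g gE] := choice ex.
have uniq n c : W (n - kact c v) -> g n = c.
  move=> Wn; apply/eqP; rewrite -subr_eq0; apply/eqP/Wc.
  have -> : kact (g n - c) v = (n - kact c v) + -1 *: (n - kact (g n) v).
    by rewrite scaleN1r opprB [RHS]addrC addrA subrK /kact /pa_const !scalerBl.
  by apply: WD => //; apply: WZ.
have gl : linear (g : N -> S).
  move=> a x y; apply: uniq.
  (* The correction term lies in [W] because [a - aug i a] sends [m0] into the kernel of [f]. *)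
  have -> : a *: x + y - kact ((a *: (g x : S) : S) + (g y : S) : k) v =
      (a *: (x - kact (g x) v) + (y - kact (g y) v))
      + u (kact (g x) ((a - pa_const Q (aug i a)) *: m0)).
    have -> : u (kact (g x) ((a - pa_const Q (aug i a)) *: m0)) =
        a *: kact (g x) v - kact (aug i a * g x) v.
      have -> m : u (kact (g x) m) = kact (g x) (u m) by apply: linearZ.
      by rewrite linearZ /= scalerBl linearB /= kactZ kactA mulrC.
    have aux (V : zmodType) (X Y P R D : V) :
        X + Y - (D + R) = X - P + (Y - R) + (P - D).
      rewrite [X - P + _]addrACA -[RHS]addrA opprD [- D - R]addrC [- P - R]addrC.
      by rewrite -[- R - P + _]addrA addKr.
    by rewrite kactDl scalerBr; apply: aux.
  apply: WD; first by apply: Wl; apply: gE.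
  apply: Wu; rewrite linearZ [f _]linearZ f_m0 /= simple1Z augD augN.
  by rewrite /pa_const augZ aug1 mulr1 subrr scaler0.
exists (mk_linear gl) => m; apply: uniq.
have -> : u m - kact (f m : k) v = u (m - pa_const Q (f m : k) *: m0).
  by rewrite [RHS]linearB; congr (_ - _); apply/esym/linearZ.
apply: Wu; rewrite linearB linearZ f_m0 /= simple1Z /pa_const augZ aug1 mulr1.
exact: subrr.
Qed.
End Extension.

Lemma source_injective_simple : injective_module S.
Proof.
move=> M N u f u_inj; have [f0|] := pselect (forall m, f m = 0).
  by exists (\0 : {linear N -> S}) => x; rewrite f0.
move=> /existsNP[m fm]; pose c : k := f m.
have c0 : c != 0 by apply/eqP.
apply: (@source_extend M N u f u_inj (idem i *: kact c^-1 m)).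
  rewrite linearZ [f _]linearZ /= -/c.
  rewrite -[LHS]/(aug i (idem i) * (aug i (pa_const Q c^-1) * c)).
  by rewrite aug_idem eqxx mul1r /pa_const augZ aug1 mulr1 mulVf.
by rewrite scalerA idem_idem.
Qed.
End InjectiveSimple.

(** * The perpendicular category of the partner in terms of the counit *)

Section Partner.
Variables (k : fieldType) (Q : quiver) (i : Q).
Local Notation A := (path_alg k Q).
Local Notation S := (simple_module k i).
Local Notation idem := (idem k).
Local Notation arrow := (arrow k).
Local Notation ifox := (ifox i).
Local Notation iarr := (iarr k i).
Local Notation isrc := (isrc k i).
Local Notation Ktens := (Ktens i).

Section Counit.
Variable N : lmodType A.

Section MkKtens.
Variables (m : N) (nu : arr Q -> N).
Hypotheses (nu_src : forall b, isrc b *: nu b = nu b)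
  (nu_sum : idem i *: m = \sum_b iarr b *: nu b).
Definition mk_Ktens_val : Kpre N := (m, [ffun b => nu b]).
Fact mk_Ktens_subproof : Ktens_pred i mk_Ktens_val.
Proof.
apply/Ktens_predP; split=> [|b] /=; last by rewrite ffunE nu_src.
rewrite nu_sum; apply: eq_bigr => b _; rewrite [in RHS]ffunE; reflexivity.
Qed.
Definition mk_Ktens : Ktens N := exist _ mk_Ktens_val mk_Ktens_subproof.
End MkKtens.

Lemma counit_injP : injective (@Ktens_counit _ _ i N) <->
  forall nu : arr Q -> N, (forall b, isrc b *: nu b = nu b) ->
    \sum_b iarr b *: nu b = 0 -> forall b, nu b = 0.
Proof.
split=> [inj nu nus nu0 b|nuP].
  have x0 : Ktens_counit (mk_Ktens nus (etrans (scaler0 _ _) (esym nu0))) =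
    Ktens_counit (0 : Ktens N) by [].
  have /(congr1 (fun x : Ktens N => (val x).2 b)) := inj _ _ x0.
  by rewrite /= !ffunE.
apply: raddf_inj => x x0; apply: KtensP => // b; rewrite [RHS]ffunE.
apply: nuP; first exact: Ktens_src.
by rewrite -Ktens_idem -[(val x).1]/(Ktens_counit x) x0 scaler0.
Qed.

Lemma counit_surjP : (forall n, exists x, @Ktens_counit _ _ i N x = n) <->
  forall n : N, exists2 nu : arr Q -> N, forall b, isrc b *: nu b = nu b &
    idem i *: n = \sum_b iarr b *: nu b.
Proof.
split=> surj n.
  have [x <-] := surj n.
  by exists (fun b => (val x).2 b) => [b|]; [exact: Ktens_src|exact: Ktens_idem].
by have [nu nus nuE] := surj n; exists (mk_Ktens nus nuE).
Qed.
End Counit.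

Section Source.
Hypothesis source : forall b : arr Q, tgt b != i.
Variable N : lmodType A.
Local Notation P := (proj_module k i).

Fact idem_proj_subproof : proj_pred i (idem i).
Proof. exact/eqP/idem_idem. Qed.
Definition idem_proj : P := exist _ (idem i) idem_proj_subproof.

Lemma proj_scaleE (x : P) : x = (val x : A) *: idem_proj.
Proof. by apply/val_inj/esym/eqP/(valP x). Qed.

Lemma Ext_proj_eq0 (e : ExtQ P N) : e = 0.
Proof.
pose s (x : P) : free_cover P := (val x : A) *: fbasis A idem_proj.
have sl : linear s by move=> a x y; rewrite /s /= scalerDl scalerA.
have ps x : cover_map P (mk_linear sl x) = (idfun : {linear P -> P}) x.
  by rewrite linearZ /= /cover_map lin_ext_basis -proj_scaleE.
have pt x : (idfun : {linear P -> P}) (cover_map P x) = cover_map P x by [].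
apply: (ext_eq0P (kbimod N) ps pt).2 e => f.
exists (\0 : {linear P -> N}) => z.
have -> : z = 0 by apply: val_inj; apply: kerP z.
exact: linear0.
Qed.

Lemma Hom_proj_eq0 :
  (forall f : HomQ P N, f = 0) <-> forall n : N, idem i *: n = 0.
Proof.
split=> [f0 n|N0 f].
  pose f (x : P) : N := (val x : A) *: n.
  have fl : linear f by move=> a x y; rewrite /f /= scalerDl scalerA.
  exact: (congr1 (fun g : HomQ P N => (g : {linear P -> N}) idem_proj)
    (f0 (mk_linear fl))).
have e : idem i *: idem_proj = idem_proj by apply/val_inj/idem_idem.
by apply: linear_eq => x; rewrite [x]proj_scaleE -e !linearZ /= !N0.
Qed.

(** With no arrow into [i], [K (x) N] retains only the components at [j != i], so the counit is
    bijective exactly when [e_i N = Hom(P_i, N)] vanishes. *)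
Lemma proj_perp :
  (forall f : HomQ P N, f = 0) /\ (forall e : ExtQ P N, e = 0) <->
  injective (@Ktens_counit _ _ i N) /\
  forall n, exists x, @Ktens_counit _ _ i N x = n.
Proof.
rewrite Hom_proj_eq0 counit_injP counit_surjP; split=> [[N0 _]|[_ surj]].
  split=> [nu nus _ b|n]; first by rewrite -nus isrc_eq0 // scale0r.
  exists (fun=> 0) => [b|]; first by rewrite scaler0.
  by rewrite N0 big1 // => b _; rewrite scaler0.
split=> [n|]; last exact: Ext_proj_eq0.
by have [nu _ ->] := surj n; rewrite big1 // => b _; rewrite iarr_eq0 // scale0r.
Qed.
End Source.

Section TauInverse.
Local Notation DS := (dual S).
Local Notation F := (tau_inv S).
Local Notation P0 := {ffun arr Q -> A^o}.

Fact dual_one_linear : linear (fun x : kvect S => (x : k) : k^o).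
Proof.
move=> c x y; congr (_ + _).
by rewrite -[LHS]/(aug i (pa_const Q c) * x) /pa_const augZ aug1 mulr1.
Qed.
Definition dual_one : DS := mk_linear dual_one_linear.

Lemma dual_scaleE (x : A) (c : k) :
  (((x : A^c) *: dual_one : DS) : {linear kvect S -> k^o}) c = aug i x * c.
Proof. by []. Qed.

Lemma dual_ann (x : A) : (x : A^c) *: dual_one = 0 <-> aug i x = 0.
Proof.
split=> [x0|x0].
  by rewrite -[LHS]mulr1 -dual_scaleE x0.
by apply: linear_eq => c; rewrite dual_scaleE x0 mul0r.
Qed.

Lemma dual_gen (y : DS) : exists x : A, (x : A^c) *: dual_one = y.
Proof.
pose c : k := (y : {linear kvect S -> k^o}) (1 : k).
exists (pa_const Q c); apply: linear_eq => d.
rewrite dual_scaleE /pa_const augZ aug1 mulr1 mulrC.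
have {2}-> : d = (d : k) *: ((1 : k) : kvect S).
  by rewrite -[RHS]/(aug i (pa_const Q d) * 1) /pa_const augZ aug1 !mulr1.
by rewrite linearZ.
Qed.

Variable N : lmodType A.

(** [DS] is cyclic with annihilator [K], the sum of [(1 - e_i) A] and the [b A]. Hence [tau^-1 S] is
    the cokernel of [A -> sum of the A e_(src b)], and its Hom and Ext conditions are injectivity
    and surjectivity of the counit. *)
Lemma tau_inv_perp (b0 : arr Q) : tgt b0 = i ->
  (forall f : HomQ F N, f = 0) /\ (forall e : ExtQ F N, e = 0) <->
  injective (@Ktens_counit _ _ i N) /\
  forall n, exists x, @Ktens_counit _ _ i N x = n.
Proof.
move=> b0i; rewrite counit_injP counit_surjP.
have e_ann : ((1 - idem i : A) : A^c) *: dual_one = 0.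
  by apply/dual_ann; rewrite augD augN aug1 aug_idem eqxx subrr.
have beta_ann b : ((iarr b : A) : A^c) *: dual_one = 0.
  exact/dual_ann/aug_iarr.
have foxM b (z c d : A) : (z : A^c) *: dual_one = 0 ->
    ifox b (z * c + d) = ifox b z * c + ifox b d.
  by move=> /dual_ann z0; rewrite linearD /= ifoxM z0 scale0r addr0.
have fox_beta b c : ifox c (iarr b) = if b == c then isrc b else 0.
  by rewrite ifox_iarr; case: eqP => _; rewrite ?scale1r ?scale0r.
have fox_sum (z : A) : (z : A^c) *: dual_one = 0 ->
    idem i * z = \sum_b iarr b * ifox b z.
  by move=> /dual_ann z0; rewrite ifox_sum z0 scale0r add0r.
(* Stripping the first arrow [b0] divides by it on the right. This is why an arrow into [i] has to
   be at hand. *)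
have divb_beta : lfox b0 (iarr b0) = idem i.
  by rewrite iarrE // lfox_arrow eqxx scale1r b0i.
have divbM (a c d : A) : lfox b0 (a * (c * iarr b0) + d * iarr b0) =
    a * lfox b0 (c * iarr b0) + lfox b0 (d * iarr b0).
  by rewrite linearD /= lfoxM augM aug_iarr mulr0 scale0r addr0.
pose lact (a : A) : {linear (A^c)^o -> (A^c)^o} := @lmulA k Q a.
have lactE (a x : A) : lact a x = a * x :> A by [].
have [q [qs qk]] : exists q : {linear {ffun arr Q -> A^o} -> F},
    (forall y, exists x, q x = y) /\
    forall x, q x = 0 <->
      exists c : A, forall b, (x b : A) * isrc b = c * iarr b :=
  right_ext_presentation dual_gen lactE (@mulrA A) (@mul1r A) (@mulrDl A)
    e_ann beta_ann foxM fox_beta (isrc_ifox i) fox_sum.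
have HomE := Hom_cokernel_eq0 (iarr_src k i) (isrc_idem k i) qs qk N.
have ExtE := Ext_cokernel_eq0 (iarr_src k i) (isrc_idem k i) qs qk (kbimod N)
  (idem_iarr k i) divb_beta divbM.
have HomE' : (forall f : HomQ F N, f = 0) <->
    (forall (f : {linear F -> N}) y, f y = 0).
  split=> [F0 f y|F0 f]; last by apply: linear_eq => y; apply: F0.
  exact: (congr1 (fun g : HomQ F N => (g : {linear F -> N}) y) (F0 f)).
split=> [[/(HomE'.1)/(HomE.1) H /(ExtE.1) E]|[/(HomE.2)/(HomE'.2) H /(ExtE.2) E]].
  exact: conj H E.
exact: conj H E.
Qed.
End TauInverse.
End Partner.

(** * The equivalence of perpendicular categories *)

Local Notation hom := Defs.hom.

Lemma isomorphism_comp (C : category) (x y z : C) (f : hom y z) (g : hom x y) :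
  isomorphism f -> isomorphism g -> isomorphism (compm f g).
Proof.
move=> [f' f'f ff'] [g' g'g gg']; exists (compm g' f').
  by rewrite Defs.compA -(Defs.compA g') f'f compm1.
by rewrite Defs.compA -(Defs.compA f) gg' compm1.
Qed.

Section NaturalIsomorphisms.
Variables (C D : category).

Lemma nat_isomorphic_sym (F G : functor C D) :
  nat_isomorphic F G -> nat_isomorphic G F.
Proof.
move=> [eta [eta_iso eta_nat]].
pose inv x := projT1 (cid2 (eta_iso x)).
have invl x : compm (inv x) (eta x) = idm (F x).
  by rewrite /inv; case: (cid2 _).
have invr x : compm (eta x) (inv x) = idm (G x).
  by rewrite /inv; case: (cid2 _).
exists inv; split=> [x|x y f]; first by exists (eta x).
rewrite -[LHS]compm1 -(invr x) Defs.compA -(Defs.compA (inv y)) -eta_nat.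
by rewrite Defs.compA invl comp1m.
Qed.

Lemma nat_isomorphic_trans (F G H : functor C D) :
  nat_isomorphic F G -> nat_isomorphic G H -> nat_isomorphic F H.
Proof.
move=> [a [a_iso a_nat]] [b [b_iso b_nat]].
exists (fun x => compm (b x) (a x)); split=> [x|x y f].
  exact: isomorphism_comp.
by rewrite -Defs.compA a_nat Defs.compA b_nat Defs.compA.
Qed.

Lemma nat_isomorphic_whiskerl (E : category) (H : functor D E)
    (F G : functor C D) :
  nat_isomorphic F G -> nat_isomorphic (H \oF F) (H \oF G).
Proof.
move=> [a [a_iso a_nat]]; exists (fun x => fmor H (a x)); split=> [x|x y f].
  have [b ba ab] := a_iso x.
  by exists (fmor H b); apply: etrans (esym (fmor_comp H _ _)) _;
    rewrite ?ba ?ab fmor_id.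
apply: etrans (esym (fmor_comp H _ _)) _; rewrite a_nat.
exact: fmor_comp.
Qed.

Lemma nat_isomorphic_whiskerr (B : category) (F G : functor C D)
    (H : functor B C) :
  nat_isomorphic F G -> nat_isomorphic (F \oF H) (G \oF H).
Proof.
move=> [a [a_iso a_nat]]; exists (fun x => a (H x)); split=> [x|x y f].
  exact: a_iso.
exact: a_nat.
Qed.
End NaturalIsomorphisms.

Lemma equivalence_nat_isomorphic (C D : category) (F G : functor C D) :
  nat_isomorphic F G -> equivalence F -> equivalence G.
Proof.
move=> FG [H [HF FH]]; have GF := nat_isomorphic_sym FG; exists H; split.
  exact: nat_isomorphic_trans (nat_isomorphic_whiskerl H GF) HF.
exact: nat_isomorphic_trans (nat_isomorphic_whiskerr H GF) FH.
Qed.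

(** This transfers the result from [Hom(K, -)] to an arbitrary left adjoint of the inclusion. *)
Lemma left_adjoint_unique (C D : category) (L L' : functor C D)
    (R : functor D C) :
  left_adjoint L R -> left_adjoint L' R -> nat_isomorphic L L'.
Proof.
move=> [phi [phi_bij phi_nat]] [psi [psi_bij psi_nat]].
pose et x := phi x (L x) (idm _); pose et' x := psi x (L' x) (idm _).
have phiE x y (u : hom (L x) y) : phi x y u = compm (fmor R u) (et x).
  have := phi_nat x x _ y (idm x) u (idm (L x)).
  by rewrite fmor_id comp1m !compm1.
have psiE x y (u : hom (L' x) y) : psi x y u = compm (fmor R u) (et' x).
  have := psi_nat x x _ y (idm x) u (idm (L' x)).
  by rewrite fmor_id comp1m !compm1.
have phi_pre x x' (f : hom x' x) y (u : hom (L x) y) :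
    phi x' y (compm u (fmor L f)) = compm (phi x y u) f.
  by have := phi_nat x x' y y f (idm y) u; rewrite fmor_id !comp1m.
have psi_pre x x' (f : hom x' x) y (u : hom (L' x) y) :
    psi x' y (compm u (fmor L' f)) = compm (psi x y u) f.
  by have := psi_nat x x' y y f (idm y) u; rewrite fmor_id !comp1m.
have phi_inj x y : injective (phi x y) by apply: bij_inj.
have psi_inj x y : injective (psi x y) by apply: bij_inj.
have alP x : {a : hom (L x) (L' x) | phi _ _ a = et' x}.
  by apply: cid; have [g _ gK] := phi_bij x (L' x); exists (g (et' x)).
have beP x : {b : hom (L' x) (L x) | psi _ _ b = et x}.
  by apply: cid; have [g _ gK] := psi_bij x (L x); exists (g (et x)).
exists (fun x => sval (alP x)); split=> [x|x y f].
  case: (alP x) => a /= aE; case: (beP x) => b bE; exists b.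
    by apply: phi_inj; rewrite phiE fmor_comp -Defs.compA -phiE aE -psiE bE.
  by apply: psi_inj; rewrite psiE fmor_comp -Defs.compA -psiE bE -phiE aE.
case: (alP x) => a /= aE; case: (alP y) => b /= bE.
apply: phi_inj; rewrite phi_pre bE [RHS]phiE fmor_comp -Defs.compA -phiE aE -psiE.
by rewrite -psi_pre comp1m.
Qed.

Lemma linear_inv (R : pzRingType) (M N : lmodType R) (f : {linear M -> N}) :
    injective f -> (forall y, exists x, f x = y) ->
  exists2 g : {linear N -> M}, forall x, g (f x) = x & forall y, f (g y) = y.
Proof.
move=> f_inj /choice[g gK].
have gl : linear g by move=> a x y; apply: f_inj; rewrite linearP !gK.
by exists (mk_linear gl) => // x; apply: f_inj; rewrite /= gK.
Qed.

Lemma perp_isomorphism (k : fieldType) (Q : quiver) (E : lmodType (path_alg k Q))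
    (M N : perp E) (f : {linear sval (sval M) -> sval (sval N)}) :
    injective f -> (forall y, exists x, f x = y) ->
  isomorphism (f : hom M N).
Proof.
move=> f_inj f_surj; have [g gK fK] := linear_inv f_inj f_surj.
by exists (g : hom N M); apply: linear_eq => x /=.
Qed.

(** * The two functors between the perpendicular categories *)

Section Reflection.
Variables (k : fieldType) (Q : quiver) (i : Q).
Local Notation A := (path_alg k Q).
Local Notation S := (simple_module k i).
Local Notation F := (partner k i).

Lemma in_perp_simple (N : ModQ k Q) : in_perp S N <->
  injective (@Khom_unit k Q i (sval N)) /\
  forall f, exists n, @Khom_unit k Q i (sval N) n = f.
Proof. by rewrite /in_perp Hom_simple_eq0 Ext_simple_eq0. Qed.

(** Injectivity of [S] amounts to [i] being a source, so the case of [tau^-1] always comes with an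
    arrow into [i]. *)
Lemma in_perp_partner (N : ModQ k Q) : in_perp F N <->
  injective (@Ktens_counit k Q i (sval N)) /\
  forall n, exists x, @Ktens_counit k Q i (sval N) x = n.
Proof.
rewrite /in_perp /partner; case: asboolP => [inj|ninj].
  exact: proj_perp (injective_simple_source inj) (sval N).
have [[b bi]|nb] := pselect (exists b : arr Q, tgt b = i).
  exact: tau_inv_perp bi.
case: ninj; apply: source_injective_simple => b.
by apply/eqP => bi; apply: nb; exists b.
Qed.

Hypothesis S_exc : exceptional S.

Lemma exceptional_Ext_eq0 (e : ExtQ S S) : e = 0.
Proof.
have [_ id_gen _] := S_exc; have [c /(congr1 snd)] := id_gen (HomQ_id S, e).
by rewrite /= scaler0.
Qed.

Let i_no_loop : no_loop i := Ext_simple_no_loop exceptional_Ext_eq0.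

Lemma exceptional_Khom_fin_gen (N : lmodType A) : fin_gen N -> fin_gen (Khom i N).
Proof.
move=> N_fg; have [_ _ /(_ N N_fg)[_ ext_fd _ _]] := S_exc.
exact: Khom_fin_gen.
Qed.

Definition Khom_mod (N : ModQ k Q) : ModQ k Q :=
  exist _ (Khom i (sval N) : lmodType A) (exceptional_Khom_fin_gen (svalP N)).
Definition Ktens_mod (N : ModQ k Q) : ModQ k Q :=
  exist _ (Ktens i (sval N) : lmodType A) (Ktens_fin_gen i_no_loop (svalP N)).

Fact Khom_mod_perp N : in_perp S (Khom_mod N).
Proof.
apply/in_perp_simple; split; first exact: Khom_unit_Khom_inj.
exact: Khom_unit_Khom_surj.
Qed.
Fact Ktens_mod_perp N : in_perp F (Ktens_mod N).
Proof.
apply/in_perp_partner; split; first exact: counit_Ktens_inj.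
exact: counit_Ktens_surj.
Qed.

Definition Khom_functor : functor (ModQ k Q) (perp S).
Proof.
refine (@Functor (ModQ k Q) (perp S)
  (fun N => exist _ (Khom_mod N) (Khom_mod_perp N))
  (fun M N f => @Khom_map k Q i (sval M) (sval N) f) _ _).
- by move=> M; apply: linear_eq => f; apply: KhomP.
- by move=> L M N f g; apply: linear_eq => h; apply: KhomP.
Defined.

Definition Ktens_functor : functor (ModQ k Q) (perp F).
Proof.
refine (@Functor (ModQ k Q) (perp F)
  (fun N => exist _ (Ktens_mod N) (Ktens_mod_perp N))
  (fun M N f => @Ktens_map k Q i (sval M) (sval N) f) _ _).
- by move=> M; apply: linear_eq => x; apply: KtensP => // b; rewrite /= ffunE.
- move=> L M N f g; apply: linear_eq => x; apply: KtensP => // b.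
  by rewrite /= !ffunE.
Defined.

Lemma Khom_functor_adjoint : left_adjoint Khom_functor (perp_incl S).
Proof.
exists (fun (N : ModQ k Q) (M : perp S)
  (u : {linear Khom i (sval N) -> sval (sval M)}) =>
    (u \o @Khom_unit k Q i (sval N) : {linear sval N -> sval (sval M)})).
split=> [N M|N N' M M' f g u]; last first.
  by apply: linear_eq => n /=; rewrite Khom_map_unit.
have /in_perp_simple[M_inj M_surj] := svalP M.
have [r rK _] := linear_inv M_inj M_surj.
(* The unit of [M] is invertible with inverse [r], so a map [N -> M] extends over [Hom(K, N)] by
   functoriality followed by [r]. *)
exists (fun v => r \o @Khom_map k Q i _ _ v :
  {linear Khom i (sval N) -> sval (sval M)}).
  move=> u; apply: linear_eq => f /=; rewrite -[RHS]rK; congr (r _).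
  by apply: KhomP => z; rewrite Khom_mapE /= -Khom_unit_app linearZ.
by move=> v; apply: linear_eq => n /=; rewrite Khom_map_unit rK.
Qed.

Lemma Khom_Ktens : nat_isomorphic
  (Khom_functor \oF (perp_incl F \oF Ktens_functor)) Khom_functor.
Proof.
exists (fun N => (@Khom_map k Q i _ _ (@Ktens_counit k Q i (sval N)) :
  {linear Khom i (Ktens i (sval N)) -> Khom i (sval N)})).
split=> [N|M N f]; last first.
  by apply: linear_eq => h; apply: KhomP.
apply: perp_isomorphism; first exact: Khom_map_counit_inj.
exact: Khom_map_counit_surj.
Qed.

Lemma Ktens_Khom : nat_isomorphic Ktens_functor
  (Ktens_functor \oF (perp_incl S \oF Khom_functor)).
Proof.
exists (fun N => (@Ktens_map k Q i _ _ (@Khom_unit k Q i (sval N)) :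
  {linear Ktens i (sval N) -> Ktens i (Khom i (sval N))})).
split=> [N|M N f]; last first.
  apply: linear_eq => x; apply: KtensP => [|b] /=; last rewrite !ffunE /=;
    exact/esym/Khom_map_unit.
apply: perp_isomorphism; first exact: Ktens_map_unit_inj.
exact: Ktens_map_unit_surj.
Qed.

Lemma Khom_perp_id :
  nat_isomorphic (functor_id (perp S)) (Khom_functor \oF perp_incl S).
Proof.
exists (fun N : perp S => (@Khom_unit k Q i (sval (sval N)) :
  {linear sval (sval N) -> Khom i (sval (sval N))})); split=> [N|M N f].
  by have /in_perp_simple[inj surj] := svalP N; apply: perp_isomorphism.
by apply: linear_eq => n; apply/esym/Khom_map_unit.
Qed.

Lemma Ktens_perp_id :
  nat_isomorphic (Ktens_functor \oF perp_incl F) (functor_id (perp F)).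
Proof.
exists (fun N : perp F => (@Ktens_counit k Q i (sval (sval N)) :
  {linear Ktens i (sval (sval N)) -> sval (sval N)})); split=> [N|M N f].
  by have /in_perp_partner[inj surj] := svalP N; apply: perp_isomorphism.
by apply: linear_eq.
Qed.

(** [K (x) -] inverts the units and [Hom(K, -)] inverts the counits, so the inner functor drops out
    of either composite; on its own perpendicular category the remaining functor is the identity. *)
Lemma Khom_equivalence : equivalence (Khom_functor \oF perp_incl F).
Proof.
exists (Ktens_functor \oF perp_incl S); split.
  apply: nat_isomorphic_trans Ktens_perp_id.
  exact: (nat_isomorphic_whiskerr (perp_incl F) (nat_isomorphic_sym Ktens_Khom)).
apply: nat_isomorphic_trans (nat_isomorphic_sym Khom_perp_id).
exact: (nat_isomorphic_whiskerr (perp_incl S) Khom_Ktens).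
Qed.
End Reflection.

Theorem corollary3p14 (k : fieldType) (Q : quiver) (i : Q)
  (S_exc : exceptional (simple_module k i)) :
  (exists pi : functor (ModQ k Q) (perp (simple_module k i)),
     left_adjoint pi (perp_incl (simple_module k i))) /\
  (forall pi : functor (ModQ k Q) (perp (simple_module k i)),
     left_adjoint pi (perp_incl (simple_module k i)) ->
     equivalence (pi \oF perp_incl (partner k i))).
Proof.
have K_adj := Khom_functor_adjoint S_exc.
split; first by exists (Khom_functor S_exc).
move=> pi pi_adj.
apply: equivalence_nat_isomorphic (Khom_equivalence S_exc).
exact/nat_isomorphic_whiskerr/left_adjoint_unique/pi_adj.
Qed.
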